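(* Let $\mathfrak R$ be an expansion of $\overline{\mathbb R}$. Every subset of $\mathbb R$ definable in $\mathfrak R$ has nonempty interior or is nowhere dense if and only if $\dim A=\operatorname{Dim}A$ for every set $A\subseteq\mathbb R^n$ ($n$ arbitrary) definable in $\mathfrak R$.
   Context: $\overline{\mathbb R}=(\mathbb R,+,\cdot,(r)_{r\in\mathbb R})$ is the real field with a constant for each real number. An expansion $\mathfrak R$ of $\overline{\mathbb R}$ may be identified with a sequence $(\mathfrak S_m)_{m\ge 1}$ such that for each $m$: $\mathfrak S_m$ is a boolean algebra of subsets of $\mathbb R^m$; if $S\in\mathfrak S_m$ then $S\times\mathbb R,\ \mathbb R\times S\in\mathfrak S_{m+1}$; if $S\in\mathfrak S_{m+1}$ then the projection of $S$ on the first $m$ coordinates is in $\mathfrak S_m$; $\{x\in\mathbb R^m: x_i=x_j\}\in\mathfrak S_m$ for $1\le i\le j\le m$; the graphs of addition and multiplication belong to $\mathfrak S_3$; and $\{r\}\in\mathfrak S_1$ for every $r\in\mathbb R$. A subset of $\mathbb R^m$ is definable in $\mathfrak R$ if it belongs to $\mathfrak S_m$ (equivalently, it is first-order definable with parameters). A coordinate projection of $S\subseteq\mathbb R^n$ is the image of $S$ under a map $(x_1,\dots,x_n)\mapsto(x_{\lambda(1)},\dots,x_{\lambda(m)})$ with $0\le m\le n$ and $\lambda\colon\{1,\dots,m\}\to\{1,\dots,n\}$ strictly increasing; $\mathbb R^0=\{0\}$ is a one-point space. Dimensions of $A\subseteq\mathbb R^n$ (usual topology, sup metric $|\cdot|$):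 - $\dim A$ is the supremum of all $k\in\mathbb N$ such that some coordinate projection of $A$ on $\mathbb R^k$ has nonempty interior ($\dim\emptyset=-\infty$). - $\operatorname{Dim}A$ is the Assouad dimension: the infimum of all $\alpha\in\mathbb R$ such that the set $\{(r/R)^\alpha\operatorname{net}_r\{y\in A:|y-x|\le R\}: x\in A,\ 0<r<R<\infty\}$ is bounded, where $\operatorname{net}_r S$ is the supremum of all $k\in\mathbb N$ for which there exist $x_1,\dots,x_k\in S$ with $|x_i-x_j|\ge r$ for all $i\ne j$ ($\operatorname{Dim}\emptyset=-\infty$). *)

(* Defs.v *)
From mathcomp Require Import all_boot all_order all_algebra.
From mathcomp Require Import all_classical all_reals all_analysis.
Import Order.TTheory GRing.Theory Num.Theory.
Import numFieldNormedType.Exports.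

Set Implicit Arguments.
Unset Strict Implicit.
Unset Printing Implicit Defensive.

Local Open Scope classical_set_scope.
Local Open Scope ring_scope.

(* [definable_pos] at index m is the boolean algebra S_(m+1) of subsets of
   R^(m+1). For x in R^(n+1), [colsub (lift ord_max) x] drops the last
   coordinate of x and [colsub (lift ord0) x] drops the first one. *)
Record expansion (R : realType) := Expansion {
  definable_pos : forall m : nat, set (set 'rV[R]_m.+1) ;
  definable_pos0 : forall m, definable_pos (set0 : set 'rV[R]_m.+1) ;
  definable_posC : forall m (A : set 'rV[R]_m.+1),
    definable_pos A -> definable_pos (~` A) ;
  definable_posU : forall m (A B : set 'rV[R]_m.+1),
    definable_pos A -> definable_pos B -> definable_pos (A `|` B) ;
  definable_posMR : forall m (A : set 'rV[R]_m.+1), definable_pos A ->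
    definable_pos [set x : 'rV[R]_m.+2 | A (colsub (lift ord_max) x)] ;
  definable_posRM : forall m (A : set 'rV[R]_m.+1), definable_pos A ->
    definable_pos [set x : 'rV[R]_m.+2 | A (colsub (lift ord0) x)] ;
  definable_pos_proj : forall m (A : set 'rV[R]_m.+2), definable_pos A ->
    definable_pos [set colsub (lift ord_max) x | x in A] ;
  definable_pos_diag : forall m (i j : 'I_m.+1), (i <= j)%N ->
    definable_pos [set x : 'rV[R]_m.+1 | x 0 i = x 0 j] ;
  definable_pos_add :
    definable_pos [set x : 'rV[R]_3 | x 0 0 + x 0 1 = x 0 2%:R] ;
  definable_pos_mul :
    definable_pos [set x : 'rV[R]_3 | x 0 0 * x 0 1 = x 0 2%:R] ;
  definable_pos_const : forall r : R,
    definable_pos [set x : 'rV[R]_1 | x 0 0 = r]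
}.

(* The sequence starts at S_1; both subsets of the one-point space R^0 are
   first-order definable. *)
Definition definable (R : realType) (M : expansion R) (n : nat) :
    set (set 'rV[R]_n) :=
  match n with
  | 0 => setT
  | m.+1 => @definable_pos R M m
  end.

Definition definable1 (R : realType) (M : expansion R) (A : set R) : Prop :=
  definable M [set x : 'rV[R]_1 | A (x 0 0)].

Definition nowhere_dense (T : topologicalType) (A : set T) : Prop :=
  (closure A)° = set0.

Definition topdim (R : realType) (n : nat) (A : set 'rV[R]_n) : \bar R :=
  ereal_sup [set k%:R%:E | k in [set k : nat |
    exists lam : 'I_k -> 'I_n, {homo lam : i j / (i < j)%N} /\
      [set colsub lam x | x in A]° !=set0]].

(* The norm of 'rV[R]_n is the sup norm, also for n = 0. *)
Definition net (R : realType) (n : nat) (r : R) (S : set 'rV[R]_n) : \bar R :=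
  ereal_sup [set k%:R%:E | k in [set k : nat |
    exists x : 'I_k -> 'rV[R]_n, (forall i, S (x i)) /\
      (forall i j, i != j -> r <= `|x i - x j|)]].

Definition assouad_bounded (R : realType) (n : nat) (A : set 'rV[R]_n)
    (alpha : R) : Prop :=
  exists C : R, forall (x : 'rV[R]_n) (r r' : R), A x -> 0 < r -> r < r' ->
    (`| ((r / r') `^ alpha)%:E * net r [set y | A y /\ (`|y - x| <= r')%R] |
      <= C%:E)%E.

Definition assouad_dim (R : realType) (n : nat) (A : set 'rV[R]_n) : \bar R :=
  ereal_inf [set alpha%:E | alpha in assouad_bounded A].

(* Main.v *)
(* Let d be the dimension of a definable set A. The inequality d <= Dim A is Baire's
   theorem: the part of A in some large ball has a somewhere dense projection.

   For the converse, assume that the definable subsets of R have interior or are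
   nowhere dense. By Baire's theorem the same holds in R^m. If no coordinate
   projection of A to R^(d+1) has interior, then no linear image of A in R^(d+1)
   has interior: replacing one column of the matrix at a time reduces this to the
   fact that a sum of nowhere dense definable subsets of R is nowhere dense, which
   is seen on the countable sets of endpoints of complementary intervals.

   Next, the images of a closed definable set G under all matrices T are uniformly
   porous as soon as each of them is nowhere dense. Otherwise definable choice gives
   a one-parameter family of nowhere dense sets which become dense in the unit cube
   as the parameter s tends to 0. If a definable subset of R oscillates at 0+, the
   family can be restricted to a definable countable sequence of parameters;
   otherwise Baire's theorem is applied to the germs at 0+.

   If Dim A = b > d, choose k with k (b - d) > 1 and apply this to G = A^k and to
   the projections of G to R^m, m = k d + 1. An averaging argument over T bounds the
   number of pairs of points of an r-separated set that become close after
   projection; uniform porosity gives a lower bound with an exponential gain, so the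
   exponent b can be lowered by a fixed amount, contradicting its minimality. *)
Require Import Defs.
From HB Require Import structures.
From mathcomp Require Import all_boot all_order all_algebra.
From mathcomp Require Import all_classical all_reals all_analysis.
From mathcomp Require Import lra ring.
Import Order.TTheory GRing.Theory Num.Theory.
Import numFieldNormedType.Exports.

Set Implicit Arguments.
Unset Strict Implicit.
Unset Printing Implicit Defensive.

Local Open Scope classical_set_scope.
Local Open Scope ring_scope.

(** * Interior, nowhere density and Baire's theorem *)

(** Registers matrices as complete normed modules, the setting of [baire]. *)
HB.instance Definition _ (R : realType) (m n : nat) := Complete.on 'M[R]_(m, n).

Section BallTopology.
Variables (R : realType) (V : normedModType R).
Implicit Types A B : set V.

Definition has_interior A :=
  exists v, exists2 e : R, 0 < e & forall w, `|w - v| < e -> A w.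

(** Only the centre [w] of the hole has to lie in the given ball; the hole may stick out, since it
    can be shrunk. *)
Definition nwd A := forall v (e : R), 0 < e ->
  exists w, exists2 e' : R, 0 < e' /\ `|w - v| < e &
    forall u, `|u - w| < e' -> ~ A u.

Lemma interiorP A v :
  A° v <-> exists2 e : R, 0 < e & forall w, `|w - v| < e -> A w.
Proof.
rewrite /interior -nbhs_ballE /=; split => -[e e0 He]; exists e => // w.
  by move=> wv; apply: He; rewrite -ball_normE /ball_ /= distrC.
by rewrite -ball_normE /ball_ /= distrC => wv; apply: He.
Qed.

Lemma has_interiorE A : A° !=set0 <-> has_interior A.
Proof.
by split => -[v] => [/interiorP Av|Av]; exists v => //; apply/interiorP.
Qed.

Lemma closureP A v :
  closure A v <-> forall e : R, 0 < e -> exists2 w, `|w - v| < e & A w.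
Proof.
split=> [cA e e0|cA B /= /interiorP[e e0 He]].
  have /cA[w []] : nbhs v [set w | `|w - v| < e] by apply/interiorP; exists e.
  by exists w.
by have [w wv Aw] := cA e e0; exists w; split => //; apply: He.
Qed.

Lemma nowhere_denseE A : nowhere_dense A <-> nwd A.
Proof.
split=> [cA0 v e e0|nA].
  have : ~ (closure A)° v by rewrite cA0.
  have [[w wv /closureP ncA]|H] :=
      pselect (exists2 w, `|w - v| < e & ~ closure A w).
    move=> _; move/existsNP : ncA => [e' /not_implyP[e'0 He']].
    exists w, e' => // u uw Au; apply: He'; exists u => //.
  move=> []; apply/interiorP; exists e => // w wv.
  by apply: contrapT => cAw; apply: H; exists w.
apply/seteqP; split=> // v /interiorP[e e0 He].
have [w [e' [e'0 /He/closureP/(_ _ e'0)[u uw Au]]]] := nA v e e0.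
by move=> /(_ u uw).
Qed.

Lemma nwd_sub A B : A `<=` B -> nwd B -> nwd A.
Proof.
move=> AB nB v e e0; have [w [e' we H]] := nB v e e0.
by exists w, e' => // u uw Au; apply: (H u uw); apply: AB.
Qed.

Lemma has_interior_sub A B : A `<=` B -> has_interior A -> has_interior B.
Proof.
by move=> AB [v [e e0 H]]; exists v, e => // w wv; apply: AB; apply: H.
Qed.

Lemma nwd_no_interior A : nwd A -> ~ has_interior A.
Proof.
move=> nA [v [e e0 H]]; have [w [e' [e'0 wv]]] := nA v e e0.
by move=> /(_ w); rewrite subrr normr0; apply => //; apply: H.
Qed.

Lemma nwd_closure A : nwd A -> nwd (closure A).
Proof.
move=> nA v e e0; have [w [e' we H]] := nA v e e0.
exists w, e' => // u uw /closureP cA.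
have /cA[x xu Ax] : 0 < e' - `|u - w| by rewrite subr_gt0.
by apply: (H x) => //; rewrite -(subrKA u) (le_lt_trans (ler_normD _ _))// -ltrBrDr.
Qed.

Lemma not_nwd A : ~ nwd A -> exists v, exists2 e : R, 0 < e &
  forall w e', 0 < e' -> `|w - v| < e -> exists2 u, `|u - w| < e' & A u.
Proof.
move=> /existsNP[v /existsNP[e /not_implyP[e0 H]]]; exists v, e => // w e' e'0 wv.
apply: contrapT => H'; apply: H; exists w, e' => // u uw Au.
by apply: H'; exists u.
Qed.

End BallTopology.

Lemma baire (R : realType) (V : completeNormedModType R) (I : countType)
    (F : I -> set V) : (forall i, nwd (F i)) ->
  forall v (e : R), 0 < e -> exists2 w, `|w - v| < e & forall i, ~ F i w.
Proof.
move=> nF v e e0.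
(* [Baire] takes a sequence of open dense sets; numbers that code no index get the whole space. *)
pose G n := if unpickle n is Some i then ~` closure (F i) else setT.
have oG n : open (G n) /\ dense (G n).
  rewrite /G; case: (unpickle n) => [i|]; last first.
    by split; [exact: openT|move=> O O0 _; rewrite setIT].
  split; first by apply: closed_openC; exact: closed_closure.
  move=> O [x Ox] oO; have /interiorP[d d0 Hd] : O° x by move: oO; rewrite openE => /(_ _ Ox).
  have [w [e' [e'0 wx] H]] := nwd_closure (nF i) x d0.
  exists w; split; first exact: Hd.
  by apply: H; rewrite subrr normr0.
have [||w [/= wv Gw]] := Baire oG (O := [set w | `|w - v| < e]).
- by exists v; rewrite /= subrr normr0.
- rewrite openE => x /= xv; apply/interiorP; exists (e - `|x - v|).
    by rewrite subr_gt0.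
  move=> w wx; rewrite /= -(subrKA x) (le_lt_trans (ler_normD _ _))//.
  by rewrite -ltrBrDr.
- exists w => // i Fw; have := Gw (pickle i) Logic.I; rewrite /G pickleK.
  by apply; apply: subset_closure.
Qed.

(** * Row vectors with the sup norm *)

Section RowVectors.
Variable R : realType.

Lemma rV_norm_lt n (x : 'rV[R]_n) (e : R) : 0 < e ->
  (`|x| < e) <-> forall i, `|x 0 i| < e.
Proof.
move=> e0; rewrite (_ : `|x| = mx_norm x)// mx_normrE; split.
  by move=> /bigmax_ltP[_ H] i; apply: (H (0, i)).
by move=> H; apply/bigmax_ltP; split=> // -[i j] _ /=; rewrite ord1.
Qed.

Lemma rV_norm_le n (x : 'rV[R]_n) (e : R) : 0 <= e ->
  (`|x| <= e) <-> forall i, `|x 0 i| <= e.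
Proof.
move=> e0; rewrite (_ : `|x| = mx_norm x)// mx_normrE; split.
  by move=> /bigmax_leP[_ H] i; apply: (H (0, i)).
by move=> H; apply/bigmax_leP; split=> // -[i j] _ /=; rewrite ord1.
Qed.

Lemma coord_norm_le n (x : 'rV[R]_n) i : `|x 0 i| <= `|x|.
Proof. by apply: (rV_norm_le x _).1. Qed.

Lemma colsub_norm n k (f : 'I_k -> 'I_n) (x : 'rV[R]_n) :
  `|colsub f x| <= `|x|.
Proof. by apply/rV_norm_le => // i; rewrite mxE; exact: coord_norm_le. Qed.

Lemma colsubB n k (f : 'I_k -> 'I_n) (x y : 'rV[R]_n) :
  colsub f (x - y) = colsub f x - colsub f y.
Proof. by apply/rowP => i; rewrite !mxE. Qed.

Lemma has_interior_colsub n k (f : 'I_k -> 'I_n) (A : set 'rV[R]_n) :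
  injective f -> has_interior A -> has_interior [set colsub f x | x in A].
Proof.
move=> finj [v [e e0 H]]; exists (colsub f v), e => // w /rV_norm_lt wv.
(* Lift [w] by filling the coordinates outside the range of [f] with those of the centre [v], so
   that [x] stays as close to [v]. *)
pose x := \row_j (if [pick i | f i == j] is Some i then w 0 i else v 0 j).
have xw i : x 0 (f i) = w 0 i.
  rewrite mxE; case: pickP => [i' /eqP/finj->//|/(_ i)]; by rewrite eqxx.
exists x; last by apply/rowP => i; rewrite mxE xw.
apply: H; apply/rV_norm_lt => // j; rewrite !mxE.
case: pickP => [i /eqP <-|_]; last by rewrite subrr normr0.
by have := wv e0 i; rewrite !mxE.
Qed.

Definition insert d (i : 'I_d.+1) (u : 'rV[R]_d) (v : R) : 'rV[R]_d.+1 :=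
  \row_j if unlift i j is Some k then u 0 k else v.

Lemma insert_lift d (i : 'I_d.+1) u v k : insert i u v 0 (lift i k) = u 0 k.
Proof. by rewrite mxE liftK. Qed.

Lemma insert_at d (i : 'I_d.+1) u v : insert i u v 0 i = v.
Proof. by rewrite mxE unlift_none. Qed.

Lemma colsub_insert d (i : 'I_d.+1) u v : colsub (lift i) (insert i u v) = u.
Proof. by apply/rowP => k; rewrite mxE insert_lift. Qed.

Lemma insertK d (i : 'I_d.+1) x : insert i (colsub (lift i) x) (x 0 i) = x.
Proof. by apply/rowP => j; rewrite mxE; case: unliftP => [k|] ->; rewrite ?mxE. Qed.

Lemma norm_insert_lt d (i : 'I_d.+1) u v u' v' e : 0 < e ->
  `|insert i u v - insert i u' v'| < e <-> `|u - u'| < e /\ `|v - v'| < e.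
Proof.
move=> e0; split=> [/rV_norm_lt H|[/rV_norm_lt H H']].
  split; last by have := H e0 i; rewrite !mxE unlift_none.
  by apply/rV_norm_lt => // k; have := H e0 (lift i k); rewrite !mxE liftK.
apply/rV_norm_lt => // j; rewrite !mxE; case: unliftP => [k|] _ //.
by have := H e0 k; rewrite !mxE.
Qed.

End RowVectors.

(** * Definable predicates and functions *)

Section Definability.
Variables (R : realType) (M : expansion R).

Definition dpred n (P : 'rV[R]_n -> Prop) := definable M (P : set 'rV[R]_n).

Lemma dpred_ext n (P Q : 'rV[R]_n -> Prop) :
  (forall x, P x <-> Q x) -> dpred P -> dpred Q.
Proof. by move=> PQ; rewrite (_ : P = Q)//; apply/funext => x; apply/propext. Qed.

Lemma dpred_not n (P : 'rV[R]_n -> Prop) : dpred P -> dpred (fun x => ~ P x).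
Proof. by case: n P => // n P; exact: definable_posC. Qed.

Lemma dpred_or n (P Q : 'rV[R]_n -> Prop) :
  dpred P -> dpred Q -> dpred (fun x => P x \/ Q x).
Proof. by case: n P Q => // n P Q; exact: definable_posU. Qed.

Lemma dpred_and n (P Q : 'rV[R]_n -> Prop) :
  dpred P -> dpred Q -> dpred (fun x => P x /\ Q x).
Proof.
move=> /dpred_not dP /dpred_not dQ.
apply: dpred_ext (dpred_not (dpred_or dP dQ)) => x.
split=> [H|[Px Qx] [/(_ Px)|/(_ Qx)]//].
by split; apply: contrapT => nX; apply: H; [left|right].
Qed.

Lemma dpred_imp n (P Q : 'rV[R]_n -> Prop) :
  dpred P -> dpred Q -> dpred (fun x => P x -> Q x).
Proof.
move=> /dpred_not dP dQ.
apply: dpred_ext (dpred_or dP dQ) => x; split=> [[]//|PQ].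
by have [Px|] := pselect (P x); [right; exact: PQ|left].
Qed.

Lemma dpred_cst n (P : Prop) : dpred (fun _ : 'rV[R]_n => P).
Proof.
have d0 : dpred (fun _ : 'rV[R]_n => False).
  by case: n => // n; exact: definable_pos0.
have [HP|HP] := pselect P; last by apply: dpred_ext d0.
by apply: dpred_ext (dpred_not d0) => x; split=> // _ [].
Qed.

Lemma dpred_all_seq n (T : eqType) (s : seq T) (P : T -> 'rV[R]_n -> Prop) :
  (forall t, dpred (P t)) -> dpred (fun x => forall t, t \in s -> P t x).
Proof.
move=> dP; elim: s => [|t s IH].
  by apply: dpred_ext (dpred_cst n True) => x; split.
apply: dpred_ext (dpred_and (dP t) IH) => x; split=> [[Pt Ps] u|H].
  by rewrite inE => /orP[/eqP->|/Ps].
by split=> [|u us]; apply: H; rewrite inE ?eqxx// us orbT.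
Qed.

Lemma dpred_all_fin n (I : finType) (P : I -> 'rV[R]_n -> Prop) :
  (forall i, dpred (P i)) -> dpred (fun x => forall i, P i x).
Proof.
move=> dP; apply: dpred_ext (dpred_all_seq (enum I) dP) => x.
by split=> H i; [apply: H; rewrite mem_enum | move=> _; exact: H].
Qed.

(* Total environments, read as 0 beyond n, avoid casts between the types
   'rV_(n + k) and 'rV_(k + n). *)
Definition env n (x : 'rV[R]_n) (i : nat) : R :=
  if insub i is Some j then x 0 j else 0.

Lemma env_ord n (x : 'rV[R]_n) (i : 'I_n) : env x i = x 0 i.
Proof. by rewrite /env valK. Qed.

Lemma env_out n (x : 'rV[R]_n) i : (n <= i)%N -> env x i = 0.
Proof. by move=> ni; rewrite /env insubF// ltnNge ni. Qed.

Definition denv n (P : (nat -> R) -> Prop) := dpred (fun x : 'rV[R]_n => P (env x)).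

Lemma denv_ext n (P Q : (nat -> R) -> Prop) :
  (forall x : 'rV_n, P (env x) <-> Q (env x)) -> denv n P -> denv n Q.
Proof. exact: dpred_ext. Qed.

Lemma denv_shift n P : denv n P -> denv n.+1 (fun e => P (fun i => e i.+1)).
Proof.
have E (x : 'rV_n.+1) : env (colsub (lift ord0) x) = fun i => env x i.+1.
  apply/funext => i; have [iltn|iltn] := ltnP i n; last by rewrite !env_out.
  rewrite -[i]/(val (Ordinal iltn)) env_ord mxE -env_ord; by [].
case: n E => [|n] E dP.
  apply: dpred_ext (dpred_cst 1 (P (fun=> 0))) => x; rewrite -E.
  by rewrite (_ : env _ = fun=> 0)//; apply/funext => i; rewrite env_out.
apply: dpred_ext (definable_posRM dP) => x.
by rewrite /mkset E.
Qed.

Lemma env_insert n (x : 'rV[R]_n) y :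
  env (insert ord_max x y) = fun i => if i == n then y else env x i.
Proof.
apply/funext => i; case: eqP => [->|/eqP ni].
  by rewrite -[n]/(val (@ord_max n)) env_ord insert_at.
have [iltn|iltn] := ltnP i n.
  rewrite -[X in env x X]/(val (Ordinal iltn)) env_ord -(insert_lift ord_max x y).
  by rewrite -env_ord /= /bump leqNgt iltn.
by rewrite !env_out// ltn_neqAle eq_sym ni.
Qed.

Lemma denv_ex n P : denv n.+1 P ->
  denv n (fun e => exists y, P (fun i => if i == n then y else e i)).
Proof.
case: n => // n dP.
apply: dpred_ext (definable_pos_proj dP) => x; split.
  move=> [z Pz <-]; exists (z 0 ord_max).
  by rewrite -env_insert insertK.
move=> [y]; rewrite -env_insert => Py.
by exists (insert ord_max x y) => //; rewrite colsub_insert.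
Qed.

Lemma denv_exs n k P : denv (n + k) P -> denv n (fun e => exists y : nat -> R,
  P (fun i => if (n <= i < n + k)%N then y i else e i)).
Proof.
elim: k P => [|k IH] P.
  rewrite addn0; apply: dpred_ext => x.
  have E y : (fun i => if (n <= i < n)%N then y i else env x i) = env x.
    by apply/funext => i; rewrite ltnNge; case: (n <= i)%N.
  by split=> [Px|[y]]; [exists (fun=> 0)|]; rewrite E.
rewrite addnS => /denv_ex/IH; apply: dpred_ext => x.
split=> [[y [z]]|[y]].
  set u := (X in P X); move=> Pu.
  exists (fun i => if i == (n + k)%N then z else y i).
  rewrite (_ : (fun _ => _) = u)//; apply/funext => i; rewrite /u ltnS.
  case: eqP => [->|]; first by rewrite leq_addr leqnn.
  by move=> /eqP nik; rewrite [in RHS]ltn_neqAle nik.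
set u := (X in P X); move=> Pu; exists y, (y (n + k)%N).
rewrite (_ : (fun _ => _) = u)//; apply/funext => i; rewrite /u ltnS.
case: eqP => [->|]; first by rewrite leq_addr leqnn.
by move=> /eqP nik; rewrite [in LHS]ltn_neqAle nik.
Qed.

Lemma denv_eq n i j : (i < n)%N -> (j < n)%N -> denv n (fun e => e i = e j).
Proof.
case: n => // n; wlog ij : i j / (i <= j)%N => [H|] ltin ltjn.
  case/orP: (leq_total i j) => ij; first exact: H.
  by apply: denv_ext (H _ _ ij ltjn ltin) => x; split.
have := definable_pos_diag M (i := Ordinal ltin) (j := Ordinal ltjn) ij.
apply: dpred_ext => x.
by rewrite /mkset -!env_ord.
Qed.

(** The axioms only add or project coordinates at the ends. An arbitrary substitution [f] is reached
    by adjoining [k] fresh coordinates after the first [n], equating the i-th of them with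
    coordinate [f i] by diagonals, and projecting them away. *)
Lemma denv_subst k n P (f : nat -> nat) : (forall i, (i < k)%N -> (f i < n)%N) ->
  denv k P -> denv n (fun e => P (fun i => if (i < k)%N then e (f i) else 0)).
Proof.
move=> fn dP.
have dP' : denv (n + k) (fun e => P (fun i => e (n + i)%N)).
  by elim: (n) => [|m] //; exact: (denv_shift (P := fun e => P (fun i => e (m + i)%N))).
have deq : denv (n + k) (fun e => forall i : 'I_k, e (n + i)%N = e (f i)).
  apply: dpred_all_fin => i; apply: denv_eq; rewrite ?ltn_add2l//.
  by apply: leq_trans (leq_addr _ _); apply: fn.
pose Q (e : nat -> R) := P (fun i => e (n + i)%N) /\
  forall i : 'I_k, e (n + i)%N = e (f i).
have dQ : denv (n + k) Q by exact: dpred_and.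
apply: dpred_ext (denv_exs dQ) => x; rewrite /Q.
have E y : (fun i => if (n <= n + i < n + k)%N then y (n + i)%N else env x (n + i))
    = fun i => if (i < k)%N then y (n + i)%N else 0.
  apply/funext => i; rewrite leq_addr ltn_add2l /=; case: ifP => // _.
  by rewrite env_out// leq_addr.
have F (i : 'I_k) y :
    (if (n <= f i < n + k)%N then y (f i) else env x (f i)) = env x (f i).
  by rewrite leqNgt fn.
split=> [[y [+ eqy]]|Px]; first rewrite E.
  set u := (X in P X); move=> Pu; rewrite (_ : (fun _ => _) = u)//.
  apply/funext => i; rewrite /u; case: ifP => // ik.
  have := eqy (Ordinal ik); rewrite F /= => <-.
  by rewrite leq_addr ltn_add2l ik.
pose y i := env x (f (i - n)%N); exists y; rewrite E; split.
  set u := (X in P X); rewrite (_ : u = (fun i => if (i < k)%N then env x (f i) else 0))//.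
  by apply/funext => i; rewrite /u /y addKn.
by move=> i; rewrite F leq_addr ltn_add2l ltn_ord /= /y addKn.
Qed.

Lemma dpred_colsub k n (P : 'rV_k -> Prop) (f : 'I_k -> 'I_n) :
  dpred P -> dpred (fun x => P (colsub f x)).
Proof.
move=> dP; have dP' : denv k (fun e => P (\row_(i < k) e i)).
  apply: dpred_ext dP => x; rewrite (_ : (\row_i _) = x)//.
  by apply/rowP => i; rewrite mxE env_ord.
pose g i := if insub i is Some j then f j : nat else 0%N.
have gE (i : 'I_k) : g i = f i by rewrite /g valK.
apply: dpred_ext (denv_subst (f := g) _ dP') => [x|i ik].
  rewrite (_ : (\row_i _) = colsub f x)//; apply/rowP => i.
  by rewrite !mxE ltn_ord gE env_ord.
by rewrite -[i]/(val (Ordinal ik)) gE.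
Qed.

Lemma dpred_ex_rV n k (P : 'rV_n -> 'rV_k -> Prop) :
  dpred (fun z : 'rV_(n + k) => P (lsubmx z) (rsubmx z)) ->
  dpred (fun x => exists y, P x y).
Proof.
move=> dP; pose Q (e : nat -> R) := P (\row_i e i) (\row_i e (n + i)%N).
have dQ : denv (n + k) Q.
  apply: dpred_ext dP => z; rewrite /Q.
  rewrite (_ : (\row_i _) = lsubmx z); last first.
    by apply/rowP => i; rewrite !mxE -env_ord.
  rewrite (_ : (\row_i _) = rsubmx z)//.
  by apply/rowP => i; rewrite !mxE -env_ord.
apply: dpred_ext (denv_exs dQ) => x; rewrite /Q.
have E y : \row_(i < n) (if (n <= i < n + k)%N then y i else env x i) = x.
  by apply/rowP => i; rewrite mxE leqNgt ltn_ord /= env_ord.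
split=> [[y]|[y Py]]; first by rewrite E => Py; exists (\row_i
  (if (n <= n + i < n + k)%N then y (n + i)%N else env x (n + i))).
pose z i := env y (i - n)%N; exists z; rewrite E.
rewrite (_ : (\row_i _) = y)//; apply/rowP => i.
by rewrite /z mxE leq_addr ltn_add2l ltn_ord /= addKn env_ord.
Qed.

Lemma dpred_all_rV n k (P : 'rV_n -> 'rV_k -> Prop) :
  dpred (fun z : 'rV_(n + k) => P (lsubmx z) (rsubmx z)) ->
  dpred (fun x => forall y, P x y).
Proof.
move=> /dpred_not dP.
apply: dpred_ext (dpred_not (dpred_ex_rV (P := fun x y => ~ P x y) dP)) => x.
by split=> [H y|H [y]]; [apply: contrapT => nP; apply: H; exists y | apply; exact: H].
Qed.

Lemma dpred_ex_R n (P : 'rV_n -> R -> Prop) :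
  dpred (fun z : 'rV_(n + 1) => P (lsubmx z) (rsubmx z 0 0)) ->
  dpred (fun x => exists y, P x y).
Proof.
move=> dP; apply: dpred_ext (dpred_ex_rV (P := fun x y => P x (y 0 0)) dP) => x.
split=> [[y Py]|[y Py]]; first by exists (y 0 0).
by exists (\row_i y); rewrite mxE.
Qed.

Lemma dpred_all_R n (P : 'rV_n -> R -> Prop) :
  dpred (fun z : 'rV_(n + 1) => P (lsubmx z) (rsubmx z 0 0)) ->
  dpred (fun x => forall y, P x y).
Proof.
move=> /dpred_not dP.
apply: dpred_ext (dpred_not (dpred_ex_R (P := fun x y => ~ P x y) dP)) => x.
by split=> [H y|H [y]]; [apply: contrapT => nP; apply: H; exists y | apply; exact: H].
Qed.

Definition dfun n (f : 'rV_n -> R) :=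
  dpred (fun z : 'rV_(n + 1) => f (lsubmx z) = rsubmx z 0 0).

Definition dmx n p q (f : 'rV_n -> 'M[R]_(p, q)) :=
  forall i j, dfun (fun x => f x i j).

Lemma dfun_ext n (f g : 'rV_n -> R) : f =1 g -> dfun f -> dfun g.
Proof. by move=> /funext->. Qed.

Lemma dpred_coord_eq n (i j : 'I_n) : dpred (fun x => x 0 i = x 0 j).
Proof.
apply: dpred_ext (denv_eq (ltn_ord i) (ltn_ord j)) => x.
by rewrite !env_ord.
Qed.

Lemma dfun_coord n (i : 'I_1) (j : 'I_n) : dfun (fun x => x i j).
Proof.
apply: dpred_ext (dpred_coord_eq (lshift 1 j) (rshift n 0)) => x.
by rewrite !mxE ord1.
Qed.

Lemma dfun_graph n k (f : 'rV_n -> R) (i : 'I_k) : dfun f ->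
  dpred (fun z : 'rV_(n + k) => f (lsubmx z) = rsubmx z 0 i).
Proof.
pose g (j : 'I_(n + 1)) : 'I_(n + k) :=
  match fintype.split j with inl j => lshift k j | inr _ => rshift n i end.
move=> df; apply: dpred_ext (dpred_colsub g df) => z.
rewrite (_ : lsubmx (colsub g z) = lsubmx z); last first.
  by apply/rowP => j; rewrite !mxE /g (unsplitK (inl j)).
by rewrite (_ : rsubmx (colsub g z) 0 0 = rsubmx z 0 i)// !mxE /g (unsplitK (inr 0)).
Qed.

(** [P (f x)] becomes the existence of [y] with [f x = y] and [P y], which only uses the graphs of
    the entries of [f]. *)
Lemma dpred_app n k (f : 'rV_n -> 'rV_k) (P : 'rV_k -> Prop) :
  dmx f -> dpred P -> dpred (fun x => P (f x)).
Proof.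
move=> df dP.
have : dpred (fun x => exists y : 'rV_k, (forall i, f x 0 i = y 0 i) /\ P y).
  apply: dpred_ex_rV; apply: dpred_and.
    by apply: dpred_all_fin => i; apply: (dfun_graph (f := fun x => f x 0 i)).
  apply: dpred_ext (dpred_colsub (@rshift n k) dP) => z.
  by rewrite (_ : colsub _ _ = rsubmx z)//; apply/rowP => i; rewrite !mxE.
apply: dpred_ext => x; split=> [[y [/rowP-> //]]|Px].
by exists (f x).
Qed.

Lemma dpred_app3 n (P : 'rV_3 -> Prop) (f g h : 'rV[R]_n -> R) :
  dfun f -> dfun g -> dfun h -> dpred P ->
  dpred (fun x => P (\row_(i < 3) [:: f x; g x; h x]`_i)).
Proof.
move=> df dg dh; apply: dpred_app => i [[|[|[|//]]] Hj].
- by apply: dfun_ext df => x; rewrite mxE.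
- by apply: dfun_ext dg => x; rewrite mxE.
- by apply: dfun_ext dh => x; rewrite mxE.
Qed.

Lemma dfun_comp n k (f : 'rV_n -> 'rV_k) (g : 'rV_k -> R) :
  dmx f -> dfun g -> dfun (fun x => g (f x)).
Proof.
move=> df; rewrite /dfun => dg.
have H : dmx (fun z : 'rV_(n + 1) => row_mx (f (lsubmx z)) (rsubmx z)).
  move=> i j; rewrite (ord1 i); case: (split_ordP j) => k' ->.
    have : dpred (fun z : 'rV_(n + 1 + 1) => f (lsubmx (lsubmx z)) 0 k' = rsubmx z 0 0).
      pose g' (j : 'I_(n + 1)) : 'I_(n + 1 + 1) :=
        match fintype.split j with inl j => lshift 1 (lshift 1 j) | inr _ => rshift (n + 1) 0 end.
      apply: dpred_ext (dpred_colsub g' (df 0 k')) => z.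
      rewrite (_ : lsubmx (colsub g' z) = lsubmx (lsubmx z)); last first.
        by apply/rowP => l; rewrite !mxE /g' (unsplitK (inl l)).
      by rewrite (_ : rsubmx (colsub g' z) 0 0 = rsubmx z 0 0)// !mxE /g' (unsplitK (inr 0)).
    by apply: dpred_ext => z; rewrite row_mxEl.
  apply: dpred_ext (dfun_coord 0 (rshift n k')) => z.
  by rewrite row_mxEr !mxE.
apply: dpred_ext (dpred_app H dg) => z.
by rewrite row_mxKl row_mxKr.
Qed.

Lemma dmx_id n : dmx (fun x : 'rV_n => x).
Proof. by move=> i j; exact: dfun_coord. Qed.

Lemma dmx_lsub n p q r (f : 'rV_n -> 'M[R]_(p, q + r)) :
  dmx f -> dmx (fun x => lsubmx (f x)).
Proof.
by move=> df i j; apply: dpred_ext (df i (lshift r j)) => z; rewrite !mxE.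
Qed.

Lemma dmx_rsub n p q r (f : 'rV_n -> 'M[R]_(p, q + r)) :
  dmx f -> dmx (fun x => rsubmx (f x)).
Proof.
by move=> df i j; apply: dpred_ext (df i (rshift q j)) => z; rewrite !mxE.
Qed.

Lemma dmx_colsub n p q r (g : 'I_r -> 'I_q) (f : 'rV_n -> 'M[R]_(p, q)) :
  dmx f -> dmx (fun x => colsub g (f x)).
Proof. by move=> df i j; apply: dpred_ext (df i (g j)) => z; rewrite !mxE. Qed.

Lemma dmx_vec n p q (f : 'rV_n -> 'rV_(p * q)) :
  dmx f -> dmx (fun x => vec_mx (f x)).
Proof.
by move=> df i j; apply: dpred_ext (df 0 (mxvec_index i j)) => z; rewrite !mxE.
Qed.

Lemma dmx_row n p q (f : 'rV_n -> 'M[R]_(p, q)) k :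
  dmx f -> dmx (fun x => row k (f x)).
Proof. by move=> df i j; apply: dpred_ext (df k j) => z; rewrite !mxE. Qed.

Lemma dfun_entry n p q (f : 'rV_n -> 'M[R]_(p, q)) i j :
  dmx f -> dfun (fun x => f x i j).
Proof. exact. Qed.

Lemma dfun_cst n (c : R) : dfun (fun _ : 'rV_n => c).
Proof.
have d : dpred (fun x : 'rV_1 => x 0 0 = c) := definable_pos_const M c.
by apply: dpred_ext (dpred_app (dmx_rsub (@dmx_id (n + 1))) d) => z; split.
Qed.

Lemma dmx_cst n p q (c : 'M[R]_(p, q)) : dmx (fun _ : 'rV_n => c).
Proof. by move=> i j; exact: dfun_cst. Qed.

Lemma dfun_lsub n k (f : 'rV_n -> R) :
  dfun f -> dfun (fun z : 'rV_(n + k) => f (lsubmx z)).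
Proof. by apply: dfun_comp; apply/dmx_lsub/dmx_id. Qed.

Lemma dfun_last n : dfun (fun z : 'rV_(n + 1) => rsubmx z 0 0).
Proof. by apply: dfun_entry; apply/dmx_rsub/dmx_id. Qed.

Lemma dfun_add n (f g : 'rV_n -> R) : dfun f -> dfun g -> dfun (fun x => f x + g x).
Proof.
move=> df dg.
have := dpred_app3 (dfun_lsub 1 df) (dfun_lsub 1 dg) (dfun_last n) (definable_pos_add M).
by apply: dpred_ext => z; rewrite /mkset !mxE.
Qed.

Lemma dfun_mul n (f g : 'rV_n -> R) : dfun f -> dfun g -> dfun (fun x => f x * g x).
Proof.
move=> df dg.
have := dpred_app3 (dfun_lsub 1 df) (dfun_lsub 1 dg) (dfun_last n) (definable_pos_mul M).
by apply: dpred_ext => z; rewrite /mkset !mxE.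
Qed.

Lemma dfun_opp n (f : 'rV_n -> R) : dfun f -> dfun (fun x => - f x).
Proof.
move=> df; apply: dfun_ext (dfun_mul (dfun_cst n (-1)) df) => x.
by rewrite mulN1r.
Qed.

Lemma dfun_sub n (f g : 'rV_n -> R) : dfun f -> dfun g -> dfun (fun x => f x - g x).
Proof. by move=> df /dfun_opp; exact: dfun_add. Qed.

Lemma dfun_sum n (I : finType) (f : I -> 'rV_n -> R) :
  (forall i, dfun (f i)) -> dfun (fun x => \sum_i f i x).
Proof.
move=> df; elim: (index_enum I) => [|i s IH].
  by apply: dfun_ext (dfun_cst n 0) => x; rewrite big_nil.
by apply: dfun_ext (dfun_add (df i) IH) => x; rewrite big_cons.
Qed.

Lemma dmx_add n p q (f g : 'rV_n -> 'M[R]_(p, q)) :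
  dmx f -> dmx g -> dmx (fun x => f x + g x).
Proof.
by move=> df dg i j; apply: dfun_ext (dfun_add (df i j) (dg i j)) => x; rewrite mxE.
Qed.

Lemma dmx_sub n p q (f g : 'rV_n -> 'M[R]_(p, q)) :
  dmx f -> dmx g -> dmx (fun x => f x - g x).
Proof.
by move=> df dg i j; apply: dfun_ext (dfun_sub (df i j) (dg i j)) => x; rewrite !mxE.
Qed.

Lemma dmx_mul n p q r (f : 'rV_n -> 'M[R]_(p, q)) (g : 'rV_n -> 'M[R]_(q, r)) :
  dmx f -> dmx g -> dmx (fun x => f x *m g x).
Proof.
move=> df dg i j; apply: dfun_ext (dfun_sum (fun k => dfun_mul (df i k) (dg k j))) => x.
by rewrite mxE.
Qed.

Lemma dmx_insert n d (i : 'I_d.+1) (f : 'rV_n -> 'rV_d) (g : 'rV_n -> R) :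
  dmx f -> dfun g -> dmx (fun x => insert i (f x) (g x)).
Proof.
move=> df dg k j; have [l|] := unliftP i j => ->.
  by apply: dfun_ext (df 0 l) => x; rewrite (ord1 k) insert_lift.
by apply: dfun_ext dg => x; rewrite (ord1 k) insert_at.
Qed.

Lemma dpred_eq n (f g : 'rV_n -> R) : dfun f -> dfun g -> dpred (fun x => f x = g x).
Proof.
move=> df dg.
have : dpred (fun x => exists y, f x = y /\ g x = y).
  by apply: dpred_ex_R; apply: dpred_and.
by apply: dpred_ext => x; split=> [[y [-> ->]]|fg] //; exists (f x).
Qed.

Lemma dpred_eq_mx n p q (f g : 'rV_n -> 'M[R]_(p, q)) :
  dmx f -> dmx g -> dpred (fun x => f x = g x).
Proof.
move=> df dg; have : dpred (fun x => forall i j, f x i j = g x i j).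
  by apply: dpred_all_fin => i; apply: dpred_all_fin => j; exact: dpred_eq.
by apply: dpred_ext => x; split=> [/matrixP//|->].
Qed.

(** The order comes from multiplication: a difference is nonnegative when it is a square. *)
Lemma dpred_le n (f g : 'rV_n -> R) : dfun f -> dfun g -> dpred (fun x => f x <= g x).
Proof.
move=> df dg.
have : dpred (fun x => exists y, f x + y * y = g x).
  apply: dpred_ex_R; apply: dpred_eq; last exact: dfun_lsub.
  by apply: dfun_add; [exact: dfun_lsub|apply: dfun_mul; exact: dfun_last].
apply: dpred_ext => x; split=> [[y <-]|fg]; first by rewrite lerDl -expr2 sqr_ge0.
by exists (Num.sqrt (g x - f x)); rewrite -expr2 sqr_sqrtr ?subr_ge0// subrKC.
Qed.

Lemma dpred_lt n (f g : 'rV_n -> R) : dfun f -> dfun g -> dpred (fun x => f x < g x).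
Proof.
move=> df dg; apply: dpred_ext (dpred_not (dpred_le dg df)) => x.
by rewrite ltNge; split=> /negP.
Qed.

Lemma dfun_norm n (f : 'rV_n -> R) : dfun f -> dfun (fun x => `|f x|).
Proof.
move=> df.
have : dpred (fun z : 'rV_(n + 1) => 0 <= rsubmx z 0 0 /\
    f (lsubmx z) * f (lsubmx z) = rsubmx z 0 0 * rsubmx z 0 0).
  have dl := dfun_last n; have df' := dfun_lsub 1 df.
  apply: dpred_and; first exact: dpred_le (dfun_cst _ 0) dl.
  by apply: dpred_eq; exact: dfun_mul.
apply: dpred_ext => z; split=> [[z0]|<-].
  rewrite -!expr2 -[X in X = _](real_normK (num_real _)) => /eqP.
  by rewrite eqrXn2// => /eqP.
by split=> //; rewrite -!expr2 real_normK ?num_real.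
Qed.

Lemma dpred_norm_lt n k (v : 'rV_n -> 'rV_k) (f : 'rV_n -> R) :
  dmx v -> dfun f -> dpred (fun x => `|v x| < f x).
Proof.
move=> dv df.
have : dpred (fun x => 0 < f x /\ forall i, `|v x 0 i| < f x).
  apply: dpred_and; first exact: dpred_lt (dfun_cst _ 0) df.
  by apply: dpred_all_fin => i; apply: dpred_lt => //; exact: dfun_norm.
apply: dpred_ext => x; split=> [[f0]|vf]; first by move/(rV_norm_lt _ f0).
by have f0 := le_lt_trans (normr_ge0 _) vf; split=> //; apply/rV_norm_lt.
Qed.

Lemma dpred_norm_le n k (v : 'rV_n -> 'rV_k) (f : 'rV_n -> R) :
  dmx v -> dfun f -> dpred (fun x => `|v x| <= f x).
Proof.
move=> dv df.
have : dpred (fun x => 0 <= f x /\ forall i, `|v x 0 i| <= f x).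
  apply: dpred_and; first exact: dpred_le (dfun_cst _ 0) df.
  by apply: dpred_all_fin => i; apply: dpred_le => //; exact: dfun_norm.
apply: dpred_ext => x; split=> [[f0]|vf]; first by move/(rV_norm_le _ f0).
by have f0 := le_trans (normr_ge0 _) vf; split=> //; apply/rV_norm_le.
Qed.

Lemma dpred_app1 (F : R -> Prop) n (f : 'rV_n -> R) :
  dpred (fun x : 'rV_1 => F (x 0 0)) -> dfun f -> dpred (fun x => F (f x)).
Proof.
move=> dF df; have : dmx (fun x => \row_(i < 1) f x).
  by move=> i j; apply: dfun_ext df => x; rewrite mxE.
by move=> /dpred_app/(_ dF); apply: dpred_ext => x; rewrite mxE.
Qed.

Lemma dpred_family m (S : R -> set 'rV[R]_m) n (f : 'rV_n -> R) (g : 'rV_n -> 'rV_m) :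
  dpred (fun z : 'rV_(m + 1) => S (rsubmx z 0 0) (lsubmx z)) ->
  dfun f -> dmx g -> dpred (fun x => S (f x) (g x)).
Proof.
move=> dS df dg; have : dmx (fun x => row_mx (g x) (\row_(i < 1) f x)).
  move=> i j; rewrite (ord1 i); case: (split_ordP j) => k ->.
    by apply: dfun_ext (dg 0 k) => x; rewrite row_mxEl.
  by apply: dfun_ext df => x; rewrite row_mxEr mxE.
move=> /dpred_app/(_ dS); apply: dpred_ext => x.
by rewrite row_mxKl row_mxKr mxE.
Qed.

End Definability.

(** Follows the syntax of a first-order formula: hypotheses about definable sets, then connectives,
    quantifiers, atomic relations and terms. Rules with the same pattern, such as quantifiers over
    reals, vectors and finite types, are told apart by typing when the first one fails to apply. *)
Ltac definability_step := match goal with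
  | H : ?G |- ?G => exact H
  | H : dpred ?M (fun x => ?F (fun_of_matrix x _ _)) |- dpred ?M (fun x => ?F (@?f x)) =>
      apply: (@dpred_app1 _ M F _ f H)
  | H : dpred ?M ?F |- dpred ?M (fun x => ?F (@?f x)) =>
      apply: (fun df => @dpred_app _ M _ _ f F df H)
  | H : definable ?M ?F |- dpred ?M (fun x => ?F (@?f x)) =>
      apply: (fun df => @dpred_app _ M _ _ f F df H)
  | H : dpred ?M (fun z => ?S (fun_of_matrix (rsubmx z) _ _) (lsubmx z))
      |- dpred ?M (fun x => ?S (@?f x) (@?g x)) =>
      apply: (@dpred_family _ M _ S _ f g H)
  | |- dpred ?M (fun _ => ?P) => apply: dpred_cst
  | |- dpred ?M (fun x => ~ @?P x) => apply: (@dpred_not _ M _ P)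
  | |- dpred ?M (fun x => @?P x /\ @?Q x) => apply: (@dpred_and _ M _ P Q)
  | |- dpred ?M (fun x => @?P x \/ @?Q x) => apply: (@dpred_or _ M _ P Q)
  | |- dpred ?M (fun x => @?P x -> @?Q x) => apply: (@dpred_imp _ M _ P Q)
  | |- dpred ?M (fun x => exists y, @?P x y) => apply: (@dpred_ex_R _ M _ P)
  | |- dpred ?M (fun x => exists y, @?P x y) => apply: (@dpred_ex_rV _ M _ _ P)
  | |- dpred ?M (fun x => forall y, @?P x y) => apply: (@dpred_all_R _ M _ P)
  | |- dpred ?M (fun x => forall y, @?P x y) => apply: (@dpred_all_rV _ M _ _ P)
  | |- dpred ?M (fun x => forall y, @?P x y) =>
      apply (@dpred_all_fin _ M _ _ (fun y x => P x y)); intro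
  | |- dpred ?M (fun x => is_true (Num.norm (@?f x) < @?g x)) =>
      apply: (@dpred_norm_lt _ M _ _ f g)
  | |- dpred ?M (fun x => is_true (Num.norm (@?f x) <= @?g x)) =>
      apply: (@dpred_norm_le _ M _ _ f g)
  | |- dpred ?M (fun x => is_true (@?f x < @?g x)) => apply: (@dpred_lt _ M _ f g)
  | |- dpred ?M (fun x => is_true (@?f x <= @?g x)) => apply: (@dpred_le _ M _ f g)
  | |- dpred ?M (fun x => @?f x = @?g x) => apply: (@dpred_eq _ M _ f g)
  | |- dpred ?M (fun x => @?f x = @?g x) => apply: (@dpred_eq_mx _ M _ _ _ f g)
  | |- dmx ?M (fun x => x) => apply: dmx_id
  | |- dmx ?M (fun _ => ?c) => apply: dmx_cst
  | |- dmx ?M (fun x => lsubmx (@?f x)) => apply: (@dmx_lsub _ M _ _ _ _ f)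
  | |- dmx ?M (fun x => rsubmx (@?f x)) => apply: (@dmx_rsub _ M _ _ _ _ f)
  | |- dmx ?M (fun x => mxsub _ ?h (@?f x)) => apply: (@dmx_colsub _ M _ _ _ _ h f)
  | |- dmx ?M (fun x => vec_mx (@?f x)) => apply: (@dmx_vec _ M _ _ _ f)
  | |- dmx ?M (fun x => row ?k (@?f x)) => apply: (@dmx_row _ M _ _ _ f k)
  | |- dmx ?M (fun x => @?f x *m @?g x) => apply: (@dmx_mul _ M _ _ _ _ f g)
  | |- dmx ?M (fun x => @?f x - @?g x) => apply: (@dmx_sub _ M _ _ _ f g)
  | |- dmx ?M (fun x => @?f x + @?g x) => apply: (@dmx_add _ M _ _ _ f g)
  | |- dmx ?M (fun x => insert ?i (@?f x) (@?g x)) =>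
      apply: (@dmx_insert _ M _ _ i f g)
  | |- dfun ?M (fun _ => ?c) => apply: dfun_cst
  | |- dfun ?M (fun x => @?f x + @?g x) => apply: (@dfun_add _ M _ f g)
  | |- dfun ?M (fun x => @?f x * @?g x) => apply: (@dfun_mul _ M _ f g)
  | |- dfun ?M (fun x => - @?f x) => apply: (@dfun_opp _ M _ f)
  | |- dfun ?M (fun x => `|@?f x|) => apply: (@dfun_norm _ M _ f)
  | |- dfun ?M (fun x => fun_of_matrix (@?f x) ?i ?j) =>
      apply: (@dfun_entry _ M _ _ _ f i j)
  end; cbv beta.

Ltac definability :=
  try match goal with |- definable ?M ?A => change (dpred M A) end;
  unfold mkset; cbv beta; repeat definability_step.

(** * Tame structures *)

Lemma rat_between (R : realType) (a b : R) : a < b ->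
  exists p q : rat, [/\ a < ratr p, ratr p < ratr q :> R & ratr q < b].
Proof.
move=> ab; have [q] := rat_in_itvoo ab; rewrite in_itv/= => /andP[aq qb].
have [p] := rat_in_itvoo aq; rewrite in_itv/= => /andP[ap pq].
by exists p, q.
Qed.

Definition enumerable T (A : set T) :=
  exists (I : countType) (f : I -> T), forall a, A a -> exists i, f i = a.

Lemma nwd_set1 (R : realType) (a : R) : nwd [set x | x = a].
Proof.
move=> v e e0.
have [w wv wa] : exists2 w, `|w - v| < e & w != a.
  have [->|va] := eqVneq v a; last by exists v; rewrite ?subrr ?normr0.
  exists (a + e / 2); first by rewrite addrC addKr gtr0_norm; lra.
  by apply/eqP; lra.
exists w, `|w - a|; first by rewrite normr_gt0 subr_eq0.
by move=> u + ua; rewrite ua distrC ltxx.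
Qed.

Lemma enumerable_no_interior (R : realType) (A : set R) :
  enumerable A -> ~ has_interior A.
Proof.
move=> [I [f fA]] [v [e e0 H]].
have [w wv nw] := baire (V := R) (fun i => nwd_set1 (f i)) v e0.
by have [i fi] := fA _ (H w wv); apply: (nw i).
Qed.

Definition left_ends (R : realType) (W : set R) : set R :=
  [set a | ~ W a /\ exists b, a < b /\ forall t, a < t -> t < b -> W t].

(** For a rational q at most one a outside W has (a, q] inside W, since of two such points the
    larger would lie in W. Hence q determines a, and [xget] picks it. *)
Lemma enumerable_left_ends (R : realType) (W : set R) : enumerable (left_ends W).
Proof.
pose P q := [set a : R | [/\ ~ W a, a < ratr q &
  forall t, a < t -> t <= ratr q -> W t]].
exists rat, (fun q => xget 0 (P q)) => a [nWa [b [ab Hb]]].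
have [q] := rat_in_itvoo ab; rewrite in_itv/= => /andP[aq qb].
have Pa : P q a by split=> // t at_ tq; apply: Hb => //; exact: le_lt_trans qb.
exists q; have [nWx xq Hx] := xgetPex 0 (ex_intro _ a Pa).
set x := xget _ _ in nWx xq Hx *; case: (ltgtP x a) => // xa.
  by case: nWa; apply: Hx => //; exact: ltW.
by case: nWx; case: Pa => _ _; apply => //; exact: ltW.
Qed.

Lemma dpred_left_ends (R : realType) (M : expansion R) (W : set R) :
  dpred M (fun x : 'rV_1 => W (x 0 0)) ->
  dpred M (fun x : 'rV_1 => left_ends W (x 0 0)).
Proof.
move=> dW.
by rewrite /left_ends; definability.
Qed.

Section Tame.
Variables (R : realType) (M : expansion R).

Definition tame := forall A : set R, definable1 M A -> A° !=set0 \/ nowhere_dense A.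

Hypothesis Htame : tame.

Lemma tame1 (F : set R) : dpred M (fun x : 'rV_1 => F (x 0 0)) ->
  ~ has_interior F -> nwd F.
Proof. by move=> /Htame[/has_interiorE|/nowhere_denseE]. Qed.

Definition small (F : set R) := dpred M (fun x : 'rV_1 => F (x 0 0)) /\ nwd F.

(** Just to the right of a point f of F there is a w outside [closure F]; the last point of
    [closure F] before w is a left endpoint, and it lies between f and w. *)
Lemma dense_left_ends (F : set R) : nwd F -> F `<=` closure (left_ends (~` closure F)).
Proof.
move=> nF f Ff; apply/closureP => e e0.
have e20 : 0 < e / 2 by rewrite divr_gt0.
(* Centring the ball at [f + e / 2] puts [w] strictly between [f] and [f + e]. *)
have [w [e' [e'0 wf] wF]] := nF (f + e / 2) _ e20.
have {}wf : f < w < f + e by move: wf; rewrite ltr_norml => /andP[? ?]; apply/andP; split; lra.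
case/andP: wf => fw wfe.
have nFw : ~ closure F w by move=> /closureP/(_ _ e'0)[u /wF].
pose S := [set x | x <= w /\ closure F x]; pose a := sup S.
have Sf : S f by split; [exact: ltW|exact: subset_closure].
have supS : has_sup S by split; [exists f | exists w => x []].
have fa : f <= a by exact: sup_ubound supS.2 _ Sf.
have aw : a <= w by apply: sup_le_ub => [|x []//]; exists f.
have cFa : closure F a.
  apply/closureP => d d0.
  have d20 : 0 < d / 2 by rewrite divr_gt0.
  have [x [xw cFx] ax] := sup_adherent d20 supS.
  have xa : x <= a by apply: sup_ubound supS.2 _ _; split.
  have [y yx Fy] := (closureP F x).1 cFx _ d20.
  exists y => //; move: yx ax; rewrite -/a !ltr_norml => /andP[? ?] ?.
  by apply/andP; split; lra.
have {}aw : a < w.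
  by rewrite lt_neqAle aw andbT; apply/eqP => aw'; apply: nFw; rewrite -aw'.
exists a; first by rewrite ltr_norml; apply/andP; split; lra.
split=> /=; first by apply.
exists w; split=> // t at_ tw cFt.
have : t <= a by apply: sup_ubound supS.2 _ _; split=> //; exact: ltW.
by rewrite leNgt at_.
Qed.

Lemma dpred_closure n (F : set 'rV[R]_n) : definable M F -> definable M (closure F).
Proof.
move=> dF.
have : dpred M (fun x : 'rV_n => forall e : R, 0 < e -> exists w : 'rV_n,
    `|w - x| < e /\ F w).
  by definability.
apply: dpred_ext => x; split=> [H|/closureP H e /H[w wx Fw]]; last by exists w.
by apply/closureP => e /H[w [wx Fw]]; exists w.
Qed.

Lemma dpred_closure1 (F : set R) : dpred M (fun x : 'rV_1 => F (x 0 0)) ->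
  dpred M (fun x : 'rV_1 => closure F (x 0 0)).
Proof.
move=> dF.
have : dpred M (fun x : 'rV_1 => forall e : R, 0 < e -> exists w : R,
    `|w - x 0 0| < e /\ F w).
  by definability.
apply: dpred_ext => x; split=> [H|/closureP H e /H[w wx Fw]]; last by exists w.
by apply/closureP => e /H[w [wx Fw]]; exists w.
Qed.

(* Each nowhere dense definable F lies in the closure of the countable definable
   set of left endpoints of its complementary intervals; a sum of two such
   countable sets is countable, hence nowhere dense by tameness. *)
Lemma small_add F1 F2 : small F1 -> small F2 ->
  small [set t | exists a b, [/\ F1 a, F2 b & t = a + b]].
Proof.
move=> [d1 n1] [d2 n2]; split.
  have : dpred M (fun x : 'rV_1 => exists a b, F1 a /\ F2 b /\ x 0 0 = a + b).
    definability.
  apply: dpred_ext => x; split=> -[a [b]]; first by case=> ? [? ?]; exists a, b.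
  by case; exists a, b.
pose D1 := left_ends (~` closure F1); pose D2 := left_ends (~` closure F2).
have dD1 : dpred M (fun x : 'rV_1 => D1 (x 0 0)).
  by apply: dpred_left_ends; apply: dpred_not; exact: dpred_closure1.
have dD2 : dpred M (fun x : 'rV_1 => D2 (x 0 0)).
  by apply: dpred_left_ends; apply: dpred_not; exact: dpred_closure1.
pose D := [set t | exists a b, D1 a /\ D2 b /\ t = a + b].
have nD : nwd D.
  apply: tame1.
    by rewrite /D; definability.
  apply: enumerable_no_interior.
  have [I1 [f1 H1]] := enumerable_left_ends (~` closure F1).
  have [I2 [f2 H2]] := enumerable_left_ends (~` closure F2).
  exists (I1 * I2)%type, (fun i => f1 i.1 + f2 i.2).
  by move=> t [a [b [/H1[i <-] [/H2[j <-] ->]]]]; exists (i, j).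
apply: nwd_sub (nwd_closure nD) => t [a [b [Fa Fb ->]]]; apply/closureP => e e0.
have e20 : 0 < e / 2 by rewrite divr_gt0.
have /closureP/(_ _ e20)[a' aa' Da] := dense_left_ends n1 Fa.
have /closureP/(_ _ e20)[b' bb' Db] := dense_left_ends n2 Fb.
exists (a' + b'); last by exists a', b'.
by move: aa' bb'; rewrite !ltr_norml => /andP[? ?] /andP[? ?]; apply/andP; split; lra.
Qed.

Lemma small_scale F c : small F -> small [set t | exists2 a, F a & t = a * c].
Proof.
move=> [dF nF]; split.
  have : dpred M (fun x : 'rV_1 => exists a, F a /\ x 0 0 = a * c).
    by definability.
  by apply: dpred_ext => x; split=> [[a [? ?]]|[a ? ?]]; exists a.
have [->|c0] := eqVneq c 0.
  by apply: nwd_sub (nwd_set1 0) => t [a _ ->]; rewrite /= mulr0.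
have c0' : 0 < `|c| by rewrite normr_gt0.
move=> v e e0.
have [w [e' [e'0 wv] H]] := nF (v / c) (e / `|c|) (divr_gt0 e0 c0').
have wE x y : `|x * c - y| = `|x - y / c| * `|c|.
  by rewrite -normrM mulrBl divfK.
exists (w * c), (e' * `|c|); first by rewrite mulr_gt0// wE -ltr_pdivlMr.
by move=> u + [a Fa ua]; rewrite ua wE mulfK// ltr_pM2r// => /H.
Qed.

(** Induction on the list of indices, by [small_add] and [small_scale]; it only carries some small
    set [G] containing the partial sums. *)
Lemma small_lin n (c : 'I_n -> R) (F : 'I_n -> set R) : (forall i, small (F i)) ->
  nwd [set t | exists2 x : 'I_n -> R, forall i, F i (x i) & t = \sum_i x i * c i].
Proof.
move=> sF.
suff H (s : seq 'I_n) : exists2 G, small G & forall x : 'I_n -> R,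
    (forall i, F i (x i)) -> G (\sum_(i <- s) x i * c i).
  have [G [_ nG] GF] := H (index_enum 'I_n).
  by apply: nwd_sub nG => t [x Fx ->]; exact: GF.
elim: s => [|i s [G sG GF]].
  exists [set x | x = 0]; last by move=> x _; rewrite big_nil.
  by split; [definability|exact: nwd_set1].
have := small_add (small_scale (c i) (sF i)) sG; set G' := mkset _ => sG'.
exists G' => // x Fx; exists (x i * c i), (\sum_(j <- s) x j * c j).
by split; [exists (x i)|exact: GF|rewrite big_cons].
Qed.

(** A form of the Kuratowski-Ulam theorem. [B (p, q)] holds the [u] whose fibre contains the whole
    interval from p to q; an interior of [B (p, q)] would give a box inside F. Outside all of them a
    fibre contains no interval, so tameness makes it nowhere dense. Dimension [d] enters as a
    hypothesis so that the lemma can serve in the induction of [tame_rV]. *)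
Lemma nwd_fibre d (i : 'I_d.+1) (F : set 'rV[R]_d.+1) :
  (forall A : set 'rV[R]_d, definable M A -> ~ has_interior A -> nwd A) ->
  definable M F -> ~ has_interior F ->
  exists2 B : rat * rat -> set 'rV[R]_d, forall pq, nwd (B pq) &
    forall u, (forall pq, ~ B pq u) -> nwd [set t | F (insert i u t)].
Proof.
move=> IH dF nF.
exists (fun (pq : rat * rat) => [set u : 'rV[R]_d | (ratr pq.1 < ratr pq.2 :> R) /\
    forall t, ratr pq.1 < t -> t < ratr pq.2 -> F (insert i u t)]) => [[p q]/=|u nB].
  apply: IH.
    by definability.
  move=> [u [e e0 H]]; have [pq _] := H u (ltac:(by rewrite subrr normr0)).
  apply: nF; exists (insert i u ((ratr p + ratr q) / 2)).
  exists (Num.min e ((ratr q - ratr p) / 2)).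
    by rewrite lt_min e0 divr_gt0// subr_gt0.
  move=> x; rewrite lt_min -(insertK i x) => /andP[xe xpq].
  have [ue _] := (norm_insert_lt _ _ _ _ _ e0).1 xe.
  have [|_] := (norm_insert_lt _ _ _ _ _ _).1 xpq.
    by rewrite divr_gt0// subr_gt0.
  by rewrite ltr_norml => /andP[? ?]; apply: (H _ ue).2; lra.
apply: tame1.
  by definability.
move=> [v [e e0 H]].
have [|p [q [vp pq qv]]] := @rat_between R (v - e) (v + e); first by lra.
by apply: (nB (p, q)); split=> //= t pt tq; apply: H; rewrite ltr_norml; apply/andP; split; lra.
Qed.

(** Induction on [m]. If A without interior were dense in a ball, Baire's theorem would give a [u]
    over which the fibre is nowhere dense in the ball and yet meets all its rational intervals. *)
Lemma tame_rV m (A : set 'rV[R]_m) : definable M A -> ~ has_interior A -> nwd A.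
Proof.
elim: m A => [|d IH] A dA nA.
  move=> v e e0; exists v, e; first by rewrite subrr normr0.
  move=> u _ Au; apply: nA; exists v, e => // w _.
  by rewrite (_ : w = u)//; apply/rowP; case.
apply: contrapT => /not_nwd[v [e e0 H]].
pose i := @ord_max d; pose u0 := colsub (lift i) v; pose v0 := v 0 i.
have vE : v = insert i u0 v0 by rewrite insertK.
pose A' := [set x | A x /\ `|x - v| < e].
have dA' : definable M A' by apply: dpred_and => //; definability.
have nA' : ~ has_interior A' by apply: contra_not nA; apply: has_interior_sub => x [].
have [B nB HB] := nwd_fibre i IH dA' nA'.
(* [C (p, q)] holds the [u] near [u0] over which A misses the interval from p to q. An interior of
   [C (p, q)] would give a box-shaped hole where A is dense. *)
pose C (pq : rat * rat) := [set u : 'rV[R]_d | [/\ `|u - u0| < e, v0 - e < ratr pq.1,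
  ratr pq.1 < ratr pq.2 :> R & ratr pq.2 < v0 + e] /\
  forall t, ratr pq.1 < t -> t < ratr pq.2 -> ~ A (insert i u t)].
have nC pq : nwd (C pq).
  apply: IH.
    have : dpred M (fun u => (`|u - u0| < e /\ v0 - e < ratr pq.1 /\
       (ratr pq.1 < ratr pq.2 :> R) /\ ratr pq.2 < v0 + e) /\
       forall t, ratr pq.1 < t -> t < ratr pq.2 -> ~ A (insert i u t)).
      by definability.
    by apply: dpred_ext => u; rewrite /C /=; split=> -[]; [case=> ? [? []]|case].
  move=> [u [d' d'0 Hd]].
  have [[ue vp pq' qv] _] := Hd u (ltac:(by rewrite subrr normr0)).
  have [||x] := H (insert i u ((ratr pq.1 + ratr pq.2) / 2))
    (Num.min d' ((ratr pq.2 - ratr pq.1) / 2)).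
  - by rewrite lt_min d'0 divr_gt0// subr_gt0.
  - rewrite vE; apply/norm_insert_lt => //; split=> //.
    by rewrite ltr_norml; apply/andP; split; lra.
  rewrite lt_min -(insertK i x) => /andP[xe xpq].
  have [ux _] := (norm_insert_lt _ _ _ _ _ d'0).1 xe.
  have [|_] := (norm_insert_lt _ _ _ _ _ _).1 xpq.
    by rewrite divr_gt0// subr_gt0.
  by rewrite ltr_norml => /andP[? ?]; apply: (Hd _ ux).2; lra.
have nBC (b : bool * (rat * rat)) : nwd (if b.1 then B b.2 else C b.2) by case: b.1.
have [u uu0 Hu] := baire nBC u0 e0.
have /HB nF : forall pq, ~ B pq u by move=> pq; exact: (Hu (true, pq)).
have [w [e' [e'0 wv] Hw]] := nF v0 e e0.
move: wv; rewrite ltr_norml => /andP[? ?].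
have [|p [q [wp pq qw]]] := @rat_between R (Num.max (w - e') (v0 - e)) (Num.min (w + e') (v0 + e)).
  by rewrite lt_min !gt_max; apply/andP; split; apply/andP; split; lra.
move: wp qw; rewrite gt_max lt_min => /andP[wp vp] /andP[qw qv].
apply: (Hu (false, (p, q))); split=> //= t pt tq At.
apply: (Hw t) => /=; first by rewrite ltr_norml; apply/andP; split; lra.
split=> //; rewrite vE; apply/norm_insert_lt => //; split=> //.
by rewrite ltr_norml; apply/andP; split; lra.
Qed.

(** The hypothesis covers all maps [f], injective or not, because a matrix made of unit columns may
    repeat a column. *)
Lemma nwd_linear_image n d (A : set 'rV[R]_n) (T : 'M[R]_(n, d.+1)) :
  definable M A ->
  (forall f : 'I_d.+1 -> 'I_n, ~ has_interior [set colsub f x | x in A]) ->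
  nwd [set x *m T | x in A].
Proof.
move=> dA coordA.
have dT (U : 'M[R]_(n, d.+1)) : definable M [set x *m U | x in A].
  have : dpred M (fun y => exists x : 'rV_n, A x /\ x *m U = y).
    by definability.
  by apply: dpred_ext => y; split=> -[x]; [case=> ? <-|move=> ? <-]; exists x.
apply: tame_rV => //.
(* Columns from [j] on are unit vectors: at [j = 0] the matrix is a coordinate map, at [j = d + 1]
   it is arbitrary. *)
suff H j (U : 'M[R]_(n, d.+1)) : (j <= d.+1)%N ->
    (forall i : 'I_d.+1, (j <= i)%N -> exists k, forall l, U l i = (l == k)%:R) ->
    ~ has_interior [set x *m U | x in A].
  by apply: (H d.+1) => // i; rewrite leqNgt ltn_ord.
clear T; elim: j U => [|j IH] T jd HT.
  have [f Hf] := choice (fun i => HT i isT).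
  have := coordA f; apply: contra_not; apply: has_interior_sub => y [x Ax <-].
  exists x => //; apply/rowP => i; rewrite !mxE (bigD1 (f i))//= Hf eqxx mulr1.
  by rewrite big1 ?addr0// => k kf; rewrite Hf (negbTE kf) mulr0.
pose i := Ordinal jd.
(* Column [i] becomes the k-th unit vector, so coordinate [i] of [x *m T' k] is [x 0 k]. *)
pose T' k := \matrix_(l, i') if i' == i then (l == k)%:R else T l i'.
have nF k : ~ has_interior [set x *m T' k | x in A].
  apply: IH => [|i' ji']; first exact: ltnW.
  have [->|ii'] := eqVneq i' i; first by exists k => l; rewrite mxE eqxx.
  have [|k' Hk'] := HT i'.
    by rewrite ltn_neqAle ji' andbT eq_sym.
  by exists k' => l; rewrite mxE (negbTE ii').
have HB k : exists B : rat * rat -> set 'rV[R]_d, (forall pq, nwd (B pq)) /\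
    forall u, (forall pq, ~ B pq u) ->
      nwd [set t | [set x *m T' k | x in A] (insert i u t)].
  by have [B ? ?] := nwd_fibre i (@tame_rV d) (dT (T' k)) (nF k); exists B.
have {HB}[B HB] := choice HB.
move=> [v [e e0 Hv]].
have [u uv Hu] := baire (fun k : 'I_n * (rat * rat) => (HB k.1).1 k.2)
  (colsub (lift i) v) e0.
(* If [x *m T = insert i u t], then [x 0 k] lies in [F k], because [T' k] changes column [i] only,
   and [t] is the sum of the [x 0 k * T k i]. So the fibre over [u] lies in a sum of small sets. *)
pose F k := [set t | [set x *m T' k | x in A] (insert i u t)].
have sF k : small (F k).
  split; last by apply: (HB k).2 => pq; exact: (Hu (k, pq)).
  by rewrite /F /mkset; apply: (dpred_app _ (dT (T' k))); definability.
apply: (nwd_no_interior (small_lin (fun k => T k i) sF)).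
exists (v 0 i), e => // t tv.
have [|x Ax xT] := Hv (insert i u t).
  by rewrite -(insertK i v); apply/norm_insert_lt.
exists (fun k => x 0 k); last by rewrite -(insert_at i u t) -xT mxE.
move=> k; exists x => //; rewrite -[LHS](insertK i); congr insert; last first.
  rewrite mxE (bigD1 k)//= mxE !eqxx mulr1 big1 ?addr0// => l lk.
  by rewrite mxE eqxx (negbTE lk) mulr0.
rewrite -(colsub_insert i u t) -xT; apply/rowP => i'; rewrite !mxE.
by apply: eq_bigr => l _; rewrite mxE eq_sym (negbTE (neq_lift _ _)).
Qed.

End Tame.

(** * One-parameter families *)

Section Families.
Variables (R : realType) (M : expansion R).

Definition in_cube m (z : 'rV[R]_m) := forall i, 0 <= z 0 i <= 1.

Lemma near_center_in_cube m (z : 'rV[R]_m) :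
  `|z - const_mx (1 / 2)| < 1 / 4 -> in_cube z.
Proof.
move=> zc i; have e0 : 0 < 1 / 4 :> R by lra.
have := (rV_norm_lt _ e0).1 zc i; rewrite !mxE ltr_norml => /andP[? ?].
by apply/andP; split; lra.
Qed.

Definition eventually0 (X : R -> Prop) := exists2 e : R, 0 < e &
  forall s, 0 < s -> s < e -> X s.

(** An open set whose complement consists of the points where [X] switches; it is the same for [X]
    and its negation. *)
Definition loc_const (X : R -> Prop) := [set x | exists u v, (u < x /\ x < v) /\
  ((forall t, u < t -> t < v -> X t) \/ (forall t, u < t -> t < v -> ~ X t))].

Lemma loc_constN (X : R -> Prop) : loc_const (fun s => ~ X s) = loc_const X.
Proof.
apply/seteqP; split=> x [u [v [xuv H]]]; exists u, v; split=> //.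
  by case: H => H; [right|left => t ut tv; apply: contrapT; exact: H].
by case: H => H; [right => t ut tv nX; apply: nX; exact: H|left].
Qed.

(** [c] is the supremum of the points of [s, s'] where [X] holds: constancy around [c] would extend
    [X] beyond it. *)
Lemma loc_const_connected (X : R -> Prop) s s' : s < s' -> X s -> ~ X s' ->
  exists2 c, s <= c <= s' & ~ loc_const X c.
Proof.
move=> ss' Xs nXs'; pose A := [set x | s <= x <= s' /\ X x].
have As : A s by split=> //; rewrite lexx ltW.
have supA : has_sup A by split; [exists s|exists s' => x [/andP[]]].
have cs' : sup A <= s' by apply: sup_le_ub => [|x [/andP[]]]; first by exists s.
have sc : s <= sup A by exact: sup_ubound supA.2 _ As.
exists (sup A); first by rewrite sc.
move=> [u [v [[uc cv] H]]].
have [x [/andP[sx xs'] Xx] ux] := sup_adherent (eps := sup A - u) (ltac:(lra)) supA.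
have xc : x <= sup A by apply: sup_ubound supA.2 _ _; split=> //; rewrite sx.
have {}H t : u < t -> t < v -> X t.
  case: H => H; first exact: H.
  by move=> _ _; exfalso; apply: (H x) => //; [lra|exact: le_lt_trans cv].
have cs'' : sup A < s'.
  by rewrite lt_neqAle cs' andbT; apply/eqP => E; apply: nXs'; apply: H; rewrite -E.
pose t := (sup A + Num.min v s') / 2.
have [ct tv ts'] : [/\ sup A < t, t < v & t <= s'].
    have h : sup A < Num.min v s' by rewrite lt_min cv.
    by split; rewrite /t; case: (leP v s') h => ? ?; lra.
have : t <= sup A.
  apply: sup_ubound supA.2 _ _; split; last by apply: H => //; exact: lt_trans ct.
  by rewrite ts' andbT; exact: le_trans (ltW ct).
by rewrite leNgt ct.
Qed.

Hypothesis Htame : tame M.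

Lemma loc_const_dense (X : R -> Prop) u v :
  dpred M (fun x : 'rV_1 => X (x 0 0)) -> u < v ->
  exists w, (u < w /\ w < v) /\ loc_const X w.
Proof.
move=> dX uv; pose X' := [set x | (u < x /\ x < v) /\ X x].
have [[w [e e0 H]]|nX'] := pselect (has_interior X').
  have [uwv _] : X' w by apply: H; rewrite subrr normr0.
  exists w; split=> //; exists (w - e), (w + e); split; first by lra.
  by left=> t ? ?; apply: (H t _).2; rewrite ltr_norml; apply/andP; split; lra.
have nw : nwd X'.
  by apply: (tame1 Htame) => //; rewrite /X'; definability.
have [|w [e' [e'0 wm] H]] := nw ((u + v) / 2) ((v - u) / 2); first by lra.
have {}wm : u < w /\ w < v by move: wm; rewrite ltr_norml => /andP[? ?]; split; lra.
exists w; split=> //.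
exists (Num.max u (w - e')), (Num.min v (w + e')); split.
  by rewrite gt_max lt_min; split; apply/andP; split; lra.
right=> t; rewrite gt_max lt_min => /andP[ut wt] /andP[tv tw] Xt.
by apply: (H t) => //; rewrite ltr_norml; apply/andP; split; lra.
Qed.

(** Below [e] lies a point [w] of local constancy, and oscillation forces a switching point between
    0 and [w]. The last switching point before [w] is the left end sought. *)
Lemma oscillation_left_ends (X : R -> Prop) :
  dpred M (fun x : 'rV_1 => X (x 0 0)) ->
  ~ eventually0 X -> ~ eventually0 (fun s => ~ X s) ->
  forall e : R, 0 < e -> exists2 a, 0 < a < e & left_ends (loc_const X) a.
Proof.
move=> dX nX nnX e e0.
have [w [[w0 we] Ww]] := loc_const_dense dX e0.
have [x [x0 xw nWx]] : exists x, [/\ 0 < x, x <= w & ~ loc_const X x].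
  have [s [s0 sw nXs]] : exists s, [/\ 0 < s, s < w & ~ X s].
    apply: contrapT => H; apply: nX; exists w => // s s0 sw.
    by apply: contrapT => nXs; apply: H; exists s.
  have [s' [s'0 s'w Xs']] : exists s, [/\ 0 < s, s < w & X s].
    apply: contrapT => H; apply: nnX; exists w => // s' s'0 s'w Xs'.
    by apply: H; exists s'.
  have [ss'|s's|E] := ltgtP s s'; last by rewrite E in nXs.
    have := @loc_const_connected (fun s => ~ X s) _ _ ss' nXs (fun h => h Xs').
    move=> [c /andP[sc cs']]; rewrite loc_constN => nc.
    by exists c; split=> //; lra.
  have [c /andP[sc cs'] nc] := loc_const_connected s's Xs' nXs.
  by exists c; split=> //; lra.
pose A := [set x | x <= w /\ ~ loc_const X x].
have supA : has_sup A by split; [exists x|exists w => ? []].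
have aw : sup A <= w by apply: sup_le_ub => [|? []//]; exists x.
have xa : x <= sup A by exact: sup_ubound supA.2 _ (conj xw nWx).
have nWa : ~ loc_const X (sup A).
  move=> [u [v [[ua av] H]]].
  have [y [yw nWy] ay] := sup_adherent (eps := sup A - u) (ltac:(lra)) supA.
  have ya : y <= sup A by exact: sup_ubound supA.2 _ (conj yw nWy).
  by apply: nWy; exists u, v; split=> //; lra.
have {}aw : sup A < w.
  by rewrite lt_neqAle aw andbT; apply/eqP => E; apply: nWa; rewrite E.
exists (sup A); first by apply/andP; split; lra.
split=> //; exists w; split=> // t at_ tw; apply: contrapT => nWt.
have : t <= sup A by apply: sup_ubound supA.2 _ _; split=> //; exact: ltW.
by rewrite leNgt at_.
Qed.

(* If some definable subset of R oscillates at 0+, then there is a countable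
   definable Z accumulating at 0+, and the union of S s over s in Z is nowhere
   dense although it is dense in the cube. Otherwise, each z belongs to S s
   either for all small s or for no small s, and Baire's theorem applies. *)
Lemma no_dense_family m (S : R -> set 'rV[R]_m) :
  dpred M (fun z : 'rV_(m + 1) => S (rsubmx z 0 0) (lsubmx z)) ->
  (forall s, 0 < s < 1 -> nwd (S s)) ->
  ~ (forall s z, 0 < s < 1 -> in_cube z -> exists2 w, S s w & `|w - z| <= s).
Proof.
move=> dS nS HS.
have e40 : 0 < 1 / 4 :> R by lra.
have [[X [dX nX nnX]]|Hosc] := pselect (exists X : R -> Prop,
    [/\ dpred M (fun x : 'rV_1 => X (x 0 0)), ~ eventually0 X &
    ~ eventually0 (fun s => ~ X s)]).
  pose W := loc_const X.
  have dW : dpred M (fun x : 'rV_1 => W (x 0 0)).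
    by rewrite /W /loc_const; definability.
  (* The countable definable set of parameters is [left_ends W], which accumulates at 0 by
     [oscillation_left_ends]. *)
  pose Y := [set y | exists s, (0 < s /\ s < 1) /\ left_ends W s /\ S s y].
  have dY : definable M Y.
    have dlW := dpred_left_ends dW.
    by rewrite /Y; definability.
  have nY : nwd Y.
    apply: (tame_rV Htame) => // -[v [e e0 H]].
    have [I [f fW]] := enumerable_left_ends W.
    have nF i : nwd [set y | 0 < f i < 1 /\ S (f i) y].
      have [f01|nf] := pselect (0 < f i < 1 : Prop).
        by apply: nwd_sub (nS _ f01) => y [].
      move=> u d d0; exists u, d; first by rewrite subrr normr0.
      by move=> y _ [].
    have [w wv Hw] := baire nF v e0.
    have [s [[s0 s1] [/fW[i fi] Ss]]] := H w wv.
    by apply: (Hw i); rewrite fi /=; split=> //; rewrite s0.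
  have [w [e' [e'0 /near_center_in_cube wc] Hw]] := nY (const_mx (1 / 2)) (1 / 4) e40.
  have [|a] := oscillation_left_ends dX nX nnX (e := Num.min e' 1).
    by rewrite lt_min e'0/=.
  rewrite lt_min => /and3P[a0 ae' a1] Wa.
  have [|x Sx xw] := HS a w _ wc; first by rewrite a0.
  by apply: (Hw x); [exact: le_lt_trans ae'|exists a].
(* [O k] collects the points near the centre of the cube missed by all [S s] with [s < 1 / (k + 1)].
   It contains no ball, as [S s] comes within [s] of the centre of the ball. *)
pose O (k : nat) := [set z : 'rV[R]_m | `|z - const_mx (1 / 2)| < 1 / 4 /\
  forall s, 0 < s -> s < k.+1%:R^-1 -> ~ S s z].
have nO k : nwd (O k).
  apply: (tame_rV Htame).
    by rewrite /O; definability.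
  move=> [v [e e0 H]].
  have [vc _] : O k v by apply: H; rewrite subrr normr0.
  have k0 : 0 < k.+1%:R^-1 :> R by rewrite invr_gt0.
  have k1 : k.+1%:R^-1 <= 1 :> R by rewrite invf_le1// ler1n.
  have [s [s0 se sk]] : exists s, [/\ 0 < s, s < e & s < k.+1%:R^-1].
    move: k0; move: (k.+1%:R^-1) => d d0; exists (Num.min e d / 2).
    by split; case: (leP e d) => ?; lra.
  have [|w Sw wv] := HS s v _ (near_center_in_cube vc).
    by rewrite s0 (lt_le_trans sk).
  by apply: (H w (le_lt_trans wv se)).2 Sw.
have n2 k : nwd (S k.+2%:R^-1).
  by apply: nS; rewrite invr_gt0 ltr0n /= invf_lt1 ?ltr1n.
(* A point [w] in no [S (1 / (k + 2))] and in no [O k] belongs to [S s] neither for all small s nor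
   for no small s, against [Hosc]. The shift to k + 2 keeps the parameter below 1. *)
have nSO (b : bool * nat) : nwd (if b.1 then S b.2.+2%:R^-1 else O b.2) by case: b.1.
have [w wc Hw] := baire nSO (const_mx (1 / 2)) e40.
have dXw : dpred M (fun x : 'rV_1 => S (x 0 0) w).
  by apply: (dpred_family (f := fun x : 'rV_1 => x 0 0) (g := fun=> w) dS); definability.
have eps (e : R) : 0 < e -> exists k, k.+1%:R^-1 < e.
  move=> e0; exists (Num.truncn e^-1).
  by rewrite -[ltRHS]invrK ltf_pV2 ?posrE ?invr_gt0// truncnS_gt.
apply: Hosc; exists (fun s => S s w); split=> //.
  move=> [e e0 H]; have [k ke] := eps e e0.
  apply: (Hw (true, k)) => /=; apply: H; first by rewrite invr_gt0.
  by apply: lt_trans ke; rewrite ltf_pV2 ?posrE// ltr_nat.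
move=> [e e0 H]; have [k ke] := eps e e0.
apply: (Hw (false, k)); split=> // s s0 sk.
by apply: H => //; exact: lt_trans ke.
Qed.

End Families.

(** * Definable choice and uniform porosity *)

Section Compactness.
Variable R : realType.

Lemma lipschitz_cont n (f : 'rV[R]_n -> R) (C : R) : 0 <= C ->
  (forall x y, `|f x - f y| <= C * `|x - y|) -> continuous f.
Proof.
move=> C0 H x A nA; have [e e0 He] := (interiorP (V := R) A (f x)).1 nA.
apply: (interiorP (f @^-1` A) x).2.
exists (e / (C + 1)); first by rewrite divr_gt0// ltr_wpDl.
move=> w; rewrite ltr_pdivlMr ?ltr_wpDl// => wx; apply: He.
apply: le_lt_trans (H _ _) _; apply: le_lt_trans wx.
by rewrite mulrC ler_wpM2l// lerDl.
Qed.

Lemma norm_max_le (a b a' b' e : R) : `|a - a'| <= e -> `|b - b'| <= e ->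
  `|Num.max a b - Num.max a' b'| <= e.
Proof.
rewrite !ler_norml => /andP[? ?] /andP[? ?].
by apply/andP; split; case: (leP a b) => ?; case: (leP a' b') => ?; lra.
Qed.

Lemma compact_min n (f : 'rV[R]_n -> R) (C : R) (K : set 'rV[R]_n) : 0 <= C ->
  (forall x y, `|f x - f y| <= C * `|x - y|) -> compact K -> K !=set0 ->
  exists2 c, K c & forall x, K x -> f c <= f x.
Proof.
move=> C0 H cK K0.
have [|c] := EVT_min_rV (f := f) K0 cK.
  by apply: continuous_subspaceT; exact: lipschitz_cont H.
by rewrite inE => Kc Hc; exists c => // x Kx; apply: Hc; rewrite inE.
Qed.

Lemma closedP n (K : set 'rV[R]_n) :
  (forall v, (forall e : R, 0 < e -> exists2 w, `|w - v| < e & K w) -> K v) ->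
  closed K.
Proof. by move=> H v /closureP; exact: H. Qed.

Lemma compact_norm_le n (K : set 'rV[R]_n) (r : R) :
  closed K -> compact [set x | K x /\ `|x| <= r].
Proof.
move=> cK; apply: bounded_closed_compact.
  exists r; split; first exact: num_real.
  by move=> b rb x [_ xr]; apply: le_trans xr (ltW rb).
apply: closedP => v H; split.
  by apply: cK; apply/closureP => e /H[w wv []]; exists w.
apply/ler_addgt0Pr => e /H[w wv [_ wr]].
rewrite -(subrK w v) addrC; apply: le_trans (ler_normD _ _) _.
by rewrite lerD// distrC ltW.
Qed.

Lemma mulmx_norm_le n m (g : 'rV[R]_n) (T : 'M[R]_(n, m)) (t : R) : 0 <= t ->
  (forall k j, `|T k j| <= t) -> `|g *m T| <= n%:R * `|g| * t.
Proof.
move=> t0 HT; apply/rV_norm_le => [|j]; first by rewrite !mulr_ge0.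
rewrite mxE; apply: le_trans (ler_norm_sum _ _ _) _.
have -> : n%:R * `|g| * t = \sum_(k < n) `|g| * t.
  by rewrite sumr_const card_ord -mulrA mulr_natl.
by apply: ler_sum => k _; rewrite normrM ler_pM// coord_norm_le.
Qed.

Lemma mx_entry_bound n m (T : 'M[R]_(n, m)) :
  exists2 t, 0 <= t & forall k j, `|T k j| <= t.
Proof.
exists (\sum_k \sum_j `|T k j|); first by rewrite !sumr_ge0// => *; rewrite sumr_ge0.
move=> k j; rewrite (bigD1 k)//= (bigD1 j)//= -addrA lerDl addr_ge0// sumr_ge0// => *.
by rewrite sumr_ge0.
Qed.

End Compactness.

Section Porosity.
Variables (R : realType) (M : expansion R).

(** The points of minimal norm form a compact set; minimizing the coordinates one after the other
    singles out the lexicographically least of them. After stage [j] the first [j] coordinates are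
    constant on [Y s]. *)
Lemma definable_choice L (X : R -> set 'rV[R]_L) :
  dpred M (fun z : 'rV_(L + 1) => X (rsubmx z 0 0) (lsubmx z)) ->
  (forall s, 0 < s < 1 -> closed (X s) /\ X s !=set0) ->
  exists2 Y : R -> set 'rV[R]_L,
    dpred M (fun z : 'rV_(L + 1) => Y (rsubmx z 0 0) (lsubmx z)) &
    forall s, 0 < s < 1 -> exists2 p, X s p & forall q, Y s q <-> q = p.
Proof.
move=> dX HX.
suff H j : (j <= L)%N -> exists2 Y : R -> set 'rV[R]_L,
    dpred M (fun z : 'rV_(L + 1) => Y (rsubmx z 0 0) (lsubmx z)) &
    forall s, 0 < s < 1 -> [/\ compact (Y s), Y s !=set0, Y s `<=` X s &
      forall p q, Y s p -> Y s q -> forall i : 'I_L, (i < j)%N -> p 0 i = q 0 i].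
  have [Y dY HY] := H L (leqnn L); exists Y => // s s01.
  have [_ [p Yp] YX Hp] := HY s s01.
  exists p; first exact: YX.
  move=> q; split=> [Yq|->//]; apply/rowP => i; exact: Hp.
elim: j => [_|j IH jL].
  (* Minimality of the norm is stated through bounds [r], which puts it in the form of
     [dpred_norm_le]. *)
  exists (fun s => [set p | X s p /\
    forall r, (exists q, X s q /\ `|q| <= r) -> `|p| <= r]).
    by definability.
  move=> s /HX[cX [p0 Xp0]].
  have [|p1 [Xp1 p1p0] Hp1] := @compact_min R L (fun x => `|x|) 1 _ ler01 _
      (compact_norm_le (r := `|p0|) cX) (ex_intro _ p0 (conj Xp0 (lexx _))).
    by move=> x y; rewrite mul1r ler_dist_dist.
  have Hmin q : X s q -> `|p1| <= `|q|.
    move=> Xq; have [qp0|/ltW pq0] := leP `|q| `|p0|; first exact: Hp1.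
    exact: le_trans pq0.
  rewrite (_ : mkset _ = [set x | X s x /\ `|x| <= `|p1|]).
    split=> //; first exact: compact_norm_le.
    - by exists p1; split.
    - by move=> x [].
  apply/seteqP; split=> x /= [Xx Hx]; split=> //; first by apply: Hx; exists p1.
  by move=> r [q [/Hmin pq qr]]; apply: le_trans Hx (le_trans pq qr).
have [Y dY HY] := IH (ltnW jL); pose i := Ordinal jL.
exists (fun s => [set p | Y s p /\ forall q, Y s q -> p 0 i <= q 0 i]).
  by definability.
move=> s /HY[cY Y0 YX Hj].
have [|p1 Yp1 Hp1] := @compact_min R L (fun x => x 0 i) 1 _ ler01 _ cY Y0.
  by move=> x y; rewrite mul1r; have := coord_norm_le (x - y) i; rewrite !mxE.
split.
- apply: (subclosed_compact _ cY) => [|x []//].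
  have cY' : closed (Y s) by apply: compact_closed => //; exact: norm_hausdorff.
  apply: closedP => v Hv; split.
    by apply: cY'; apply/closureP => e /Hv[w wv []]; exists w.
  move=> q Yq; apply/ler_addgt0Pr => e /Hv[w wv [_ /(_ _ Yq) wq]].
  have := le_lt_trans (coord_norm_le (w - v) i) wv; rewrite !mxE ltr_norml.
  by move=> /andP[? ?]; lra.
- by exists p1.
- by move=> x [/YX].
- move=> p q [Yp Hp] [Yq Hq] k; rewrite ltnS leq_eqVlt => /orP[/eqP kj|]; last exact: Hj.
  have -> : k = i by exact: val_inj.
  by apply/eqP; rewrite eq_le Hp// Hq.
Qed.

Lemma dpred_in_cube m : dpred M (@in_cube R m).
Proof.
have : dpred M (fun z : 'rV_m => forall i, 0 <= z 0 i /\ z 0 i <= 1) by definability.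
apply: dpred_ext => z; split=> H i; first by have [-> ->] := H i.
by have /andP[] := H i.
Qed.

Hypothesis Htame : tame M.

(** Multiplying [T] by a scalar changes the scale, so the single [eta] serves for cubes of all
    sizes. The radius [r] provides compactness, and [eta] does not depend on it. *)
Lemma uniform_porosity n m (G : set 'rV[R]_n) : definable M G -> closed G ->
  (forall T : 'M[R]_(n, m), nwd [set g *m T | g in G]) ->
  exists2 eta : R, 0 < eta & forall r y (T : 'M[R]_(n, m)),
    exists2 z, in_cube z & forall g, G g -> `|g| <= r -> eta < `|y + z - g *m T|.
Proof.
move=> dG cG nG; apply: contrapT => Hno.
(* A parameter is the row vector formed by [r], [y] and [T]. It belongs to [X s] when the image of
   the bounded part of [G] is s-dense in the unit cube translated by [y]. *)
pose X (s : R) := [set p : 'rV[R]_(1 + (m + n * m)) | forall z, in_cube z ->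
  exists g, G g /\ `|g| <= lsubmx p 0 0 /\
    `|lsubmx (rsubmx p) + z - g *m vec_mx (rsubmx (rsubmx p))| <= s].
have dC := dpred_in_cube m.
have dX : dpred M (fun z : 'rV_(1 + (m + n * m) + 1) => X (rsubmx z 0 0) (lsubmx z)).
  by rewrite /X; definability.
have X0 s : 0 < s -> X s !=set0.
  move=> s0; apply: contrapT => X0; apply: Hno; exists s => // r y T.
  apply: contrapT => H; apply: X0.
  exists (row_mx (\row_(i < 1) r) (row_mx y (mxvec T))) => z zc.
  rewrite !(row_mxKr, row_mxKl) mxvecK mxE; apply: contrapT => Hz; apply: H.
  exists z => // g Gg gr; rewrite ltNge; apply/negP => gs; apply: Hz.
  by exists g.
have cX s : closed (X s).
  apply: closedP => p Hp z zc.
  set r := lsubmx p 0 0; set y := lsubmx _; set T := vec_mx _.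
  (* A point [g] of [G] is a witness for [z] exactly when [f g <= 0]; the minimum of [f] on a
     compact part of [G] has to be shown nonpositive. *)
  pose f (g : 'rV[R]_n) := Num.max (`|g| - r) (`|y + z - g *m T| - s).
  have [t t0 HT] := mx_entry_bound T.
  have c0 : 0 <= 1 + n%:R * t by rewrite addr_ge0// mulr_ge0.
  have Hf x x' : `|f x - f x'| <= (1 + n%:R * t) * `|x - x'|.
    rewrite /f; apply: norm_max_le.
      rewrite opprB addrA subrK mulrDl mul1r (le_trans (ler_dist_dist _ _))//.
      by rewrite lerDl !mulr_ge0.
    rewrite opprB addrA subrK (le_trans (ler_dist_dist _ _))//.
    rewrite opprB addrC addrA subrK -mulmxBl distrC.
    apply: le_trans (mulmx_norm_le _ t0 HT) _.
    by rewrite mulrDl mul1r mulrAC lerDr.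
  have [K0 | nK0] := pselect ([set x | G x /\ `|x| <= `|r| + 1] !=set0); last first.
    exfalso; apply: nK0; have [p' p'p Xp'] := Hp 1 ltr01.
    have [g [Gg [gr _]]] := Xp' z zc; exists g; split=> //.
    apply: le_trans gr _.
    have : `|lsubmx p' 0 0 - r| < 1.
      apply: le_lt_trans p'p; rewrite /r; have := coord_norm_le (p' - p) (lshift _ 0).
      by rewrite !mxE.
    by have := ler_norm r; rewrite ltr_norml => ? /andP[? ?]; lra.
  have [g [Gg _] Hmin] := compact_min c0 Hf (compact_norm_le (r := `|r| + 1) cG) K0.
  have : f g <= 0.
    rewrite leNgt; apply/negP => mu0; set mu := f g in mu0 Hmin.
    (* Passing to parameters at distance [d] moves [y] by at most [d] and [g *m T] by at most
       [n * (|r| + 1) * d]. So at a witness for the nearby parameter [f] is at most [d * D], less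
       than the minimum [mu]. *)
    pose D : R := 2 + n%:R * (`|r| + 1).
    have D0 : 0 < D by rewrite ltr_wpDr// mulr_ge0// addr_ge0.
    pose d := Num.min 1 (mu / (2 * D)).
    have d0 : 0 < d by rewrite lt_min ltr01 divr_gt0// mulr_gt0.
    have d1 : d <= 1 by rewrite ge_min lexx.
    have dD : d * D < mu.
      have : d * (2 * D) <= mu by rewrite -ler_pdivlMr ?mulr_gt0// ge_min lexx orbT.
      by rewrite mulrCA; nra.
    have [p' p'p Xp'] := Hp d d0.
    have [g' [Gg' [gr' gs']]] := Xp' z zc.
    have rr : lsubmx p' 0 0 <= r + d.
      have := le_lt_trans (coord_norm_le (p' - p) (lshift _ 0)) p'p.
      by rewrite /r !mxE ltr_norml => /andP[? ?]; lra.
    have g'r : `|g'| <= `|r| + 1 by have := ler_norm r; lra.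
    have := Hmin g' (conj Gg' g'r); apply/negP; rewrite -ltNge.
    apply: le_lt_trans dD; rewrite /f ge_max /D; apply/andP; split.
      have h : 0 <= n%:R * (`|r| + 1) :> R by rewrite mulr_ge0// addr_ge0.
      have hd : d <= d * (2 + n%:R * (`|r| + 1)) by rewrite ler_peMr ?ltW//; lra.
      by apply: le_trans hd; rewrite lerBlDl; exact: le_trans gr' rr.
    pose y' := lsubmx (rsubmx p'); pose T' := vec_mx (rsubmx (rsubmx p')).
    have yy' : `|y - y'| <= d.
      apply/(rV_norm_le _ (ltW d0)) => i.
      have := coord_norm_le (p - p') (rshift 1 (lshift _ i)).
      by rewrite distrC !mxE => h; exact: le_trans h (ltW p'p).
    have TT' k j : `|(T' - T) k j| <= d.
      have := coord_norm_le (p' - p) (rshift 1 (rshift m (mxvec_index k j))).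
      by rewrite !mxE => h; exact: le_trans h (ltW p'p).
    have : y + z - g' *m T = (y' + z - g' *m T') + (y - y') + g' *m (T' - T).
      rewrite mulmxBr; move: (g' *m T) (g' *m T') => a b.
      by apply/rowP => i; rewrite !mxE; lra.
    move=> ->; rewrite lerBlDr.
    apply: le_trans (ler_normD _ _) _.
    have -> : d * (2 + n%:R * (`|r| + 1)) + s =
        (s + d) + (n%:R * (d * (`|r| + 1)) + d) by ring.
    have h1 := mulmx_norm_le g' (ltW d0) TT'.
    have h2 : `|y' + z - g' *m T' + (y - y')| <= s + d.
      by apply: le_trans (ler_normD _ _) _; rewrite lerD.
    have h3 : n%:R * `|g'| * d <= n%:R * (d * (`|r| + 1)) :> R.
      by rewrite -mulrA ler_wpM2l// mulrC ler_pM2l.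
    by apply: lerD => //; apply: le_trans h1 (le_trans h3 _); rewrite lerDl ltW.
  rewrite /f ge_max => /andP[]; rewrite !subr_le0 => ? ?; by exists g.
have [Y dY HY] := definable_choice dX (fun s s01 => conj (cX s) (X0 s (andP s01).1)).
(* The image at the chosen parameter, translated so that its cube becomes the unit cube. *)
pose S (s : R) := [set w | exists p : 'rV[R]_(1 + (m + n * m)), Y s p /\
  exists g, G g /\ `|g| <= lsubmx p 0 0 /\
    w = g *m vec_mx (rsubmx (rsubmx p)) - lsubmx (rsubmx p)].
apply: (no_dense_family Htame (S := S)).
- by rewrite /S; definability.
- move=> s /HY[p Xp Yp] v e e0; rewrite /S.
  set y := lsubmx (rsubmx p); set T := vec_mx (rsubmx (rsubmx p)).
  have [w [e' [e'0 wv] H]] := nG T (v + y) e e0.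
  exists (w - y), e'; first by split=> //; rewrite -addrA -opprD (addrC y).
  move=> u uw [q [/Yp ->]]; rewrite -/y -/T => -[g [Gg [_ ug]]].
  apply: (H (g *m T)); last by exists g.
  by move: uw; rewrite ug opprB addrA subrK.
- move=> s z /HY[p Xp Yp] /Xp[g [Gg [gr gs]]].
  exists (g *m vec_mx (rsubmx (rsubmx p)) - lsubmx (rsubmx p)).
    by exists p; split; [apply/Yp|exists g].
  by rewrite -addrA -opprD distrC.
Qed.

End Porosity.

(** * Counting points in porous sets *)

Lemma unit_interval_split (R : realType) (M : nat) (x : R) : (0 < M)%N ->
  0 <= x <= 1 -> exists k : 'I_M, k%:R <= M%:R * x <= k.+1%:R.
Proof.
move=> M0 /andP[x0 x1].
have y0 : 0 <= M%:R * x by rewrite mulr_ge0.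
have yM : M%:R * x <= M%:R by rewrite ler_piMr.
have [xM|] := ltP (M%:R * x) M%:R.
  have kM : (Num.truncn (M%:R * x) < M)%N.
    by rewrite -(ltr_nat R); apply: le_lt_trans xM; rewrite truncn_le.
  exists (Ordinal kM) => /=; apply/andP; split; first by rewrite truncn_le.
  by apply: ltW; exact: truncnS_gt.
move=> My; have kM : (M.-1 < M)%N by rewrite prednK.
exists (Ordinal kM) => /=; rewrite prednK// yM andbT.
by apply: le_trans My; rewrite ler_nat leq_pred.
Qed.

Section Cells.
Variables (R : realType) (n m M : nat) (I : finType) (e : I -> 'rV[R]_n) (eta : R).
Hypothesis M0 : (0 < M)%N.
Hypothesis etaM : M%:R^-1 <= eta.
Hypothesis porous : forall y (T : 'M[R]_(n, m)),
  exists2 z, in_cube z & forall i, eta < `|y + z - e i *m T|.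

(** Divide the cube into M^m cells. The cell of the hole [z] contains no image point, because its
    side 1 / M is at most [eta]; so M^m - 1 cells remain, and the same applies inside each of them
    after magnification. The colour is the address of a cell after [j] subdivisions. *)
Lemma porous_colouring j (T : 'M[R]_(n, m)) y (S : {set I}) :
  (forall i, i \in S -> in_cube (e i *m T - y)) ->
  exists c : I -> nat, (forall i, i \in S -> (c i < (M ^ m).-1 ^ j)%N) /\
    (forall i i', i \in S -> i' \in S -> c i = c i' ->
      `|e i *m T - e i' *m T| <= M%:R ^- j).
Proof.
have MR : 0 < M%:R :> R by rewrite ltr0n.
elim: j T y S => [|j IH] T y S HS.
  exists (fun=> 0%N); split=> // i i' iS i'S _.
  rewrite expr0 invr1; apply/rV_norm_le => // l.
  have /andP[] := HS i iS l; have /andP[] := HS i' i'S l; rewrite !mxE.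
  by move=> ? ? ? ?; rewrite ler_norml; apply/andP; split; lra.
have [z zc Hz] := porous y T.
have [k0 Hk0] := choice (fun l => unit_interval_split M0 (zc l)).
have Hk i : exists k : {ffun 'I_m -> 'I_M}, i \in S ->
    forall l, (k l)%:R <= M%:R * (e i *m T - y) 0 l <= (k l).+1%:R.
  have [iS|] := boolP (i \in S); last by exists (finfun k0).
  have [k Hk] := choice (fun l => unit_interval_split M0 (HS i iS l)).
  by exists (finfun k) => _ l; rewrite ffunE; exact: Hk.
have {Hk}[kap Hkap] := choice Hk.
pose K : seq {ffun 'I_m -> 'I_M} := enum (predC1 (finfun k0)).
have szK : size K = (M ^ m).-1.
  have := cardC1 (finfun k0 : {ffun 'I_m -> 'I_M}).
  by rewrite card_ffun !card_ord -cardE.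
have kapK i : i \in S -> kap i \in K.
  move=> iS; rewrite mem_enum inE; apply/eqP => ki.
  have := Hz i; rewrite ltNge => /negP; apply; apply: le_trans etaM.
  apply/rV_norm_le => [|l]; first by rewrite invr_ge0 ltW.
  have := Hkap i iS l; rewrite ki ffunE; have := Hk0 l.
  set a := (k0 l)%:R; rewrite -natr1 -/a !mxE => /andP[? ?] /andP[? ?].
  rewrite -(ler_pM2l MR) mulfV ?gt_eqF// -[X in X * _](gtr0_norm MR) -normrM.
  by rewrite ler_norml; apply/andP; split; lra.
have Hc (k : {ffun 'I_m -> 'I_M}) : exists c : I -> nat,
    (forall i, i \in S -> kap i = k -> (c i < (M ^ m).-1 ^ j)%N) /\
    (forall i i', i \in S -> i' \in S -> kap i = k -> kap i' = k -> c i = c i' ->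
      `|e i *m T - e i' *m T| <= M%:R ^- j.+1).
  (* Magnify cell [k] by the factor [M] to a unit cube. *)
  have [|c [c1 c2]] := IH (M%:R *: T) (M%:R *: y + \row_l (k l)%:R)
      [set i in S | kap i == k].
    move=> i; rewrite inE => /andP[iS /eqP ki] l.
    have := Hkap i iS l; rewrite ki -natr1 -scalemxAr !mxE => /andP[? ?].
    by apply/andP; split; lra.
  exists c; split=> [i iS ki|i i' iS i'S ki ki' cc].
    by apply: c1; rewrite inE iS ki eqxx.
  have := c2 i i'; rewrite !inE iS i'S ki ki' eqxx => /(_ isT isT cc).
  rewrite -!scalemxAr -scalerBr normrZ ger0_norm ?ler0n//.
  move=> H; rewrite -(ler_pM2l MR); apply: le_trans H _.
  have MN : M%:R != 0 :> R by rewrite gt_eqF.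
  suff -> : M%:R * M%:R ^- j.+1 = M%:R ^- j :> R by [].
  by rewrite exprS; field; rewrite MN expf_neq0.
have [c Hc'] := choice Hc.
(* The cell and the colour inside it are the quotient and the remainder modulo (M^m - 1)^j. *)
exists (fun i => (index (kap i) K * (M ^ m).-1 ^ j + c (kap i) i)%N); split.
  move=> i iS; have ck := (Hc' (kap i)).1 i iS erefl.
  rewrite expnS; apply: (@leq_trans ((index (kap i) K).+1 * (M ^ m).-1 ^ j)).
    by rewrite mulSn addnC ltn_add2r.
  by rewrite leq_mul2r -szK index_mem kapK// orbT.
move=> i i' iS i'S E.
have ck := (Hc' (kap i)).1 i iS erefl.
have ck' := (Hc' (kap i')).1 i' i'S erefl.
have N0 : (0 < (M ^ m).-1 ^ j)%N by exact: leq_ltn_trans ck.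
have Ei : index (kap i) K = index (kap i') K.
  have := congr1 (fun x => x %/ ((M ^ m).-1 ^ j))%N E.
  by rewrite !divnMDl// !divn_small// !addn0.
have kk : kap i = kap i'.
  by rewrite -(nth_index (kap i) (kapK i iS)) Ei nth_index// kapK.
apply: (Hc' (kap i)).2 => //; move: E; rewrite Ei => /addnI ->.
by rewrite kk.
Qed.

End Cells.

(** * Counting pairs of equal colour and averaging over grid vectors *)

Section Counting.
Variable R : realType.

(** The Cauchy-Schwarz inequality for the sizes [N k] of the colour classes, obtained from their
    variance about the mean [lam]. *)
Lemma colour_pairs (I : finType) (c : I -> nat) (K : nat) : (0 < K)%N ->
  (forall i, (c i < K)%N) ->
  #|I|%:R ^+ 2 <= K%:R * \sum_(i : I) \sum_(i' : I) (c i == c i')%:R :> R.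
Proof.
move=> K0 cK; have K0R : 0 < K%:R :> R by rewrite ltr0n.
pose N (k : 'I_K) : R := \sum_(i : I) (c i == k)%:R.
have sN : \sum_k N k = #|I|%:R.
  rewrite exchange_big/= -sum1_card natr_sum; apply: eq_bigr => i _.
  rewrite (bigD1 (Ordinal (cK i)))//= eqxx big1 ?addr0// => k.
  by rewrite -val_eqE/= eq_sym => /negbTE->.
have -> : \sum_(i : I) \sum_(i' : I) (c i == c i')%:R = \sum_k N k ^+ 2 :> R.
  transitivity (\sum_i \sum_i' \sum_(k : 'I_K) (c i == k)%:R * (c i' == k)%:R : R).
    apply: eq_bigr => i _; apply: eq_bigr => i' _.
    rewrite (bigD1 (Ordinal (cK i)))//= eqxx mul1r big1 ?addr0 1?eq_sym// => k.
    by rewrite -val_eqE/= eq_sym => /negbTE->; rewrite mul0r.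
  under eq_bigr do rewrite exchange_big/=.
  rewrite exchange_big/=; apply: eq_bigr => k _.
  rewrite expr2 mulr_suml; apply: eq_bigr => i _.
  by rewrite mulr_sumr.
pose lam := #|I|%:R / K%:R : R.
have : 0 <= \sum_k (N k - lam) ^+ 2 by apply: sumr_ge0 => k _; exact: sqr_ge0.
under eq_bigr do rewrite sqrrB.
rewrite big_split/= sumrB sumr_const card_ord.
have -> : \sum_(k < K) N k * lam *+ 2 = #|I|%:R * lam *+ 2.
  by rewrite sumrMnl -mulr_suml sN.
rewrite -[_ *+ K]mulr_natr /lam => H.
have -> : #|I|%:R ^+ 2 = K%:R * (#|I|%:R * (#|I|%:R / K%:R)) :> R.
  by rewrite expr2; field; rewrite gt_eqF.
rewrite ler_pM2l//.
have E : (#|I|%:R / K%:R) ^+ 2 * K%:R = #|I|%:R * (#|I|%:R / K%:R) :> R.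
  by rewrite expr2; field; rewrite gt_eqF.
by move: H; rewrite E -mulr_natr; lra.
Qed.

Lemma count_in_interval (Q : nat) (a b d : R) : (0 < Q)%N -> a != 0 -> 0 <= d ->
  \sum_(q < Q) (`|b + a * (q%:R / Q%:R)| <= d)%R%:R <= 2 * d * Q%:R / `|a| + 1.
Proof.
move=> Q0 a0 d0; have a0' : 0 < `|a| by rewrite normr_gt0.
have QR : 0 < Q%:R :> R by rewrite ltr0n.
pose P (q : 'I_Q) := `|b + a * (q%:R / Q%:R)| <= d.
have B0 : 0 <= 2 * d * Q%:R / `|a| by rewrite divr_ge0// !mulr_ge0.
have [q0 Pq0|nP] := pickP P; last first.
  by rewrite big1 ?addr_ge0// => q _; rewrite -/(P q) nP.
have [q1 Pq1 q1min] := arg_minnP (fun q : 'I_Q => q : nat) Pq0.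
pose B := Num.truncn (2 * d * Q%:R / `|a|).
have sub q : P q -> (q1 <= q < q1 + B.+1)%N.
  move=> Pq; have q1q := q1min q Pq; rewrite q1q /= -{1}(subnKC q1q) ltn_add2l ltnS.
  rewrite /B truncn_ge_nat// natrB// ler_pdivlMr//.
  have := ler_normB (b + a * (q%:R / Q%:R)) (b + a * (q1%:R / Q%:R)).
  rewrite opprD addrACA subrr add0r -mulrBr -mulrBl normrM.
  rewrite [`|_ / Q%:R|]ger0_norm ?divr_ge0// ?subr_ge0 ?ler_nat// mulrA => H.
  have {}H : `|a| * (q%:R - q1%:R) / Q%:R <= 2 * d.
    move: Pq1 Pq; rewrite /P => h1 h2; apply: le_trans H _.
    have -> : 2 * d = d + d by ring.
    by rewrite lerD.
  by move: H; rewrite ler_pdivrMr// mulrC.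
apply: (@le_trans _ _ (\sum_(q < Q) (q1 <= q < q1 + B.+1)%:R)).
  by apply: ler_sum => q _; rewrite ler_nat -/(P q); case: (boolP (P q)) => // /sub->.
apply: (@le_trans _ _ B.+1%:R); last first.
  by rewrite -natr1 lerD2r /B truncn_le.
rewrite -natr_sum ler_nat.
rewrite (eq_bigr (fun q : 'I_Q => if (q1 <= q < q1 + B.+1)%N then 1 else 0)%N); last first.
  by move=> q _; case: ifP.
rewrite -big_mkcond /= sum1_card.
rewrite -(size_iota q1 B.+1) cardE -(size_map val); apply: uniq_leq_size.
  by rewrite (map_inj_uniq val_inj) enum_uniq.
by move=> x /mapP[q]; rewrite mem_enum unfold_in size_iota => qP ->; rewrite mem_iota.
Qed.

Definition resample n Q (k : 'I_n) (t : {ffun 'I_n -> 'I_Q}) (q : 'I_Q) :=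
  [ffun i => if i == k then q else t i].

(** An average does not change when coordinate [k] is drawn afresh: exchanging [t k] with [q] is an
    involution on pairs. *)
Lemma resample_sum n Q (k : 'I_n) (F : {ffun 'I_n -> 'I_Q} -> R) :
  Q%:R * \sum_t F t = \sum_t \sum_q F (resample k t q).
Proof.
pose h (p : {ffun 'I_n -> 'I_Q} * 'I_Q) := (resample k p.1 p.2, p.1 k).
have hK : involutive h.
  case=> t q; rewrite /h /= ffunE eqxx; congr pair.
  by apply/ffunP => i; rewrite !ffunE; case: eqP => [->|].
rewrite pair_big/= [RHS](reindex_inj (inv_inj hK)) /=.
rewrite (eq_bigr (fun p => F p.1)); last first.
  by move=> p _; rewrite -[X in F X]/((h (h p)).1) hK.
rewrite -(pair_big xpredT xpredT (fun t _ => F t))/= mulr_sumr.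
by apply: eq_bigr => t _; rewrite sumr_const card_ord mulr_natl.
Qed.

(** A finite model of a random vector in [0, 1]^n, so that expectations are finite sums; [Q] is the
    resolution of the grid. *)
Definition grid_col n Q (t : {ffun 'I_n -> 'I_Q}) : 'cV[R]_n :=
  \col_i ((t i)%:R / Q%:R).

(** Fix all coordinates of [t] but [k], where [|v|] is attained. At most 2 d Q / |v| + 1 values of
    [t k] qualify, and [|v| <= Q * d] absorbs the 1 into the factor 3. *)
Lemma grid_col_count n Q (v : 'rV[R]_n) (d : R) : (0 < Q)%N -> 0 < d ->
  v != 0 -> `|v| <= Q%:R * d ->
  \sum_(t : {ffun 'I_n -> 'I_Q}) (`|(v *m grid_col t) 0 0| <= d)%R%:R
    <= 3 * d / `|v| * #|{ffun 'I_n -> 'I_Q}|%:R.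
Proof.
move=> Q0 d0 v0 vQ; have QR : 0 < Q%:R :> R by rewrite ltr0n.
have v0' : 0 < `|v| by rewrite normr_gt0.
have [k vk] : exists k, `|v| = `|v 0 k|.
  have [|[i k] H] := @mx_norm_neq0 R _ _ v; first by rewrite gt_eqF.
  by exists k; rewrite -(ord1 i).
have vk0 : v 0 k != 0 by rewrite -normr_gt0 -vk.
rewrite -(ler_pM2l QR) (resample_sum k) -mulrCA.
have -> : 3 * d / `|v| * (Q%:R * #|{ffun 'I_n -> 'I_Q}|%:R) =
    \sum_(t : {ffun 'I_n -> 'I_Q}) (3 * d / `|v| * Q%:R).
  by rewrite sumr_const mulrA mulr_natr.
apply: ler_sum => t _.
pose b := \sum_(i | i != k) v 0 i * ((t i)%:R / Q%:R).
rewrite (eq_bigr (fun q : 'I_Q => (`|b + v 0 k * (q%:R / Q%:R)| <= d)%R%:R)); last first.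
  move=> q _; rewrite mxE (bigD1 k)//= mxE ffunE eqxx addrC.
  congr ((`|_ + _| <= d)%R%:R); apply: eq_bigr => i ik.
  by rewrite mxE ffunE (negbTE ik).
apply: le_trans (count_in_interval _ Q0 vk0 (ltW d0)) _; rewrite -vk.
have : 1 <= d * Q%:R / `|v| by rewrite ler_pdivlMr// mul1r mulrC.
by rewrite -!mulrA [_^-1 * Q%:R]mulrC; lra.
Qed.

End Counting.

(** * Random projections *)

Section RandomProjection.
Variable R : realType.

Lemma exists_le_average (T : finType) (f : T -> R) (c : R) : (0 < #|T|)%N ->
  \sum_t f t <= c * #|T|%:R -> exists t, f t <= c.
Proof.
move=> T0 H; apply: contrapT => nt.
have lt t : c < f t by rewrite ltNge; apply/negP => ft; apply: nt; exists t.
move: H; apply/negP; rewrite -ltNge.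
have [t0 _] := card_gt0P T0.
rewrite mulr_natr -sumr_const; apply: ltr_sum => //.
by apply/hasP; exists t0; rewrite ?mem_index_enum.
Qed.

(** Columns are fixed one at a time, each no worse than average. The weights [u] record which
    vectors stayed short under the columns already chosen, and every column contributes one factor
    [w j]. *)
Lemma exists_good_matrix n m Q (J : finType) (v : J -> 'rV[R]_n) (u w : J -> R) d :
  (0 < Q)%N -> (forall j, 0 <= u j) -> (forall j, 0 <= w j) ->
  (forall j, \sum_(t : {ffun 'I_n -> 'I_Q}) (`|(v j *m grid_col R t) 0 0| <= d)%R%:R
     <= w j * #|{ffun 'I_n -> 'I_Q}|%:R) ->
  exists2 T : 'M[R]_(n, m), forall k l, 0 <= T k l <= 1 &
    \sum_j u j * (`|v j *m T| <= d)%R%:R <= \sum_j u j * w j ^+ m.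
Proof.
move=> Q0 u0 w0 Hw; elim: m u u0 => [|m IH] u u0.
  exists 0 => [k []//|]; apply: ler_sum => j _; rewrite expr0 ler_wpM2l//.
  by rewrite lern1 leq_b1.
have T0 : (0 < #|{ffun 'I_n -> 'I_Q}|)%N.
  by rewrite card_ffun card_ord expn_gt0 Q0.
have [t Ht] : exists t : {ffun 'I_n -> 'I_Q},
    \sum_j u j * w j ^+ m * (`|(v j *m grid_col R t) 0 0| <= d)%R%:R
      <= \sum_j u j * w j ^+ m.+1.
  apply: exists_le_average => //; rewrite exchange_big mulr_suml /=.
  apply: ler_sum => j _; rewrite -mulr_sumr exprSr -!mulrA.
  by rewrite ler_wpM2l// ler_wpM2l ?exprn_ge0.
have [|T HT1 HT2] := IH (fun j => u j * (`|(v j *m grid_col R t) 0 0| <= d)%R%:R).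
  by move=> j; rewrite mulr_ge0.
pose T' : 'M[R]_(n, 1 + m) := row_mx (grid_col R t) T.
have HT' k (l : 'I_(1 + m)) : 0 <= T' k l <= 1.
  rewrite /T'; case: (split_ordP l) => l' ->; last by rewrite row_mxEr.
  rewrite row_mxEl mxE divr_ge0//= ler_pdivrMr ?ltr0n// mul1r ler_nat.
  exact: ltnW.
exists T' => //; rewrite /T'.
apply: le_trans Ht; apply: le_trans (_ : _ <= _) (le_trans HT2 _); last first.
  by apply: ler_sum => j _; rewrite mulrAC.
apply: ler_sum => j _; rewrite -mulrA ler_wpM2l//.
have [H|_] := leP `|v j *m _| d; last by rewrite mulr_ge0.
have d0 : 0 <= d := le_trans (normr_ge0 _) H.
rewrite (_ : _ <= d) ?mul1r; last first.
  apply: le_trans H; have := coord_norm_le (v j *m row_mx (grid_col R t) T) (lshift m 0).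
  by rewrite mul_mx_row row_mxEl.
rewrite (_ : _ <= d)//; apply/(rV_norm_le _ d0) => l; apply: le_trans H.
have := coord_norm_le (v j *m row_mx (grid_col R t) T) (rshift 1 l).
by rewrite mul_mx_row row_mxEr.
Qed.

Lemma geometric_sum_le (x : R) k : 1 < x -> \sum_(i < k) x ^+ i <= x ^+ k / (x - 1).
Proof.
move=> x1; rewrite ler_pdivlMr ?subr_gt0// mulrC -subrX1.
by rewrite lerBlDr lerDl.
Qed.

(* Project by a random matrix T with entries in [0, 1]: on average few pairs of
   points become close, whereas porosity of the image forces many pairs to lie in
   a common small cell. *)
Lemma porous_count n m M (eta C q : R) : (0 < n)%N -> (1 < M)%N -> M%:R^-1 <= eta ->
  0 <= C -> M%:R ^+ m < q ->
  exists2 C', 0 <= C' & forall (I : finType) (e : I -> 'rV[R]_n) j r, 0 < r ->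
    (forall y (T : 'M[R]_(n, m)),
       exists2 z, in_cube z & forall i, eta < `|y + z - e i *m T|) ->
    (forall a b, `|e a - e b| <= 2 * (M%:R ^+ j * r)) ->
    (forall a i, #|[pred b | `|e a - e b| <= M%:R ^+ i * r]|%:R <= C * q ^+ i) ->
    #|I|%:R <= C' * (q * (M ^ m).-1%:R / M%:R ^+ m) ^+ j.
Proof.
move=> n0 M1 etaM C0 qM.
have M0 : (0 < M)%N by exact: ltnW.
have MR : 0 < M%:R :> R by rewrite ltr0n.
have MR1 : 1 <= M%:R :> R by rewrite ler1n.
have nR : 1 <= n%:R :> R by rewrite ler1n.
(* [x] is the ratio of the geometric series over the scales M^i r. It exceeds 1 by the hypothesis on
   [q], so the largest scale dominates. *)
pose x := q / M%:R ^+ m; pose D : R := (12 * n%:R * M%:R) ^+ m.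
have x1 : 1 < x by rewrite ltr_pdivlMr ?exprn_gt0// mul1r.
have D0 : 0 <= D by rewrite exprn_ge0// !mulr_ge0.
pose C' := D * C * x ^+ 2 / (x - 1).
have x0 : 0 < x := lt_trans ltr01 x1.
have C'0 : 0 <= C'.
  apply: divr_ge0; last by rewrite subr_ge0 ltW.
  by apply: mulr_ge0; [exact: mulr_ge0|exact: sqr_ge0].
exists C' => // I e j r r0 porous diam ball.
have [->|] := posnP #|I|.
  rewrite mulr_ge0// exprn_ge0// divr_ge0 ?exprn_ge0// mulr_ge0//.
  by rewrite (le_trans _ (ltW qM)) ?exprn_ge0.
move=> /card_gt0P[a0 _].
(* Two points count as close after projection when they are within [d]. The resolution M^j gives
   [|v p| <= Q * d] for all pairs, as [grid_col_count] asks. *)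
pose d := 4 * n%:R * r; have d0 : 0 < d by rewrite !mulr_gt0// (lt_le_trans ltr01).
pose Q := (M ^ j)%N; have Q0 : (0 < Q)%N by rewrite expn_gt0 M0.
pose v (p : I * I) := e p.1 - e p.2.
pose w p := if `|v p| <= d then 1 else 3 * d / `|v p|.
have w0 p : 0 <= w p by rewrite /w; case: ifP => // _; rewrite divr_ge0// mulr_ge0// ltW.
have Hw p : \sum_(t : {ffun 'I_n -> 'I_Q}) (`|(v p *m grid_col R t) 0 0| <= d)%R%:R
     <= w p * #|{ffun 'I_n -> 'I_Q}|%:R.
  rewrite /w; case: (leP `|v p| d) => [_|vd].
    rewrite mul1r -sum1_card natr_sum; apply: ler_sum => t _.
    by rewrite lern1 leq_b1.
  apply: grid_col_count => //; first by rewrite -normr_gt0 (lt_trans d0).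
  apply: le_trans (diam _ _) _; rewrite natrX /d (mulrCA 2) ler_pM2l ?exprn_gt0//.
  by rewrite ler_pM2r//; lra.
have [T HT1 HT2] := exists_good_matrix m Q0 (fun _ : I * I => ler01) w0 Hw.
(* Dividing [T] by [L] brings all images into one unit cube; a cell of side M^-j then corresponds to
   the distance [d] under [T]. *)
pose L := 4 * n%:R * M%:R ^+ j * r.
have L0 : 0 < L by rewrite !mulr_gt0 ?exprn_gt0// (lt_le_trans ltr01).
have dL : d = L * M%:R ^- j.
  by rewrite /L /d; field; rewrite expf_neq0// gt_eqF.
pose T' := L^-1 *: T.
have HT' p : `|v p *m T'| = `|v p *m T| / L.
  by rewrite -scalemxAr normrZ ger0_norm ?invr_ge0 ?ltW// mulrC.
pose S : {set I} := finset.setT.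
have HS i : i \in S by rewrite finset.in_setT.
have cube i : i \in S -> in_cube (e i *m T' - (e a0 *m T' - const_mx (1 / 2))).
  move=> _ l.
  have h : `|v (i, a0) *m T'| <= 1 / 2.
    rewrite HT' ler_pdivrMr//; apply: le_trans (mulmx_norm_le _ ler01 _) _.
      by move=> k l'; have /andP[? ?] := HT1 k l'; rewrite ger0_norm.
    have := diam i a0; rewrite mulr1 /L -/(v (i, a0)) => h.
    apply: (@le_trans _ _ (n%:R * (2 * (M%:R ^+ j * r)))); first by rewrite ler_wpM2l.
    by rewrite le_eqVlt; apply/orP; left; apply/eqP; field.
  have := le_trans (coord_norm_le _ l) h; rewrite /v mulmxBl !mxE ler_norml.
  by move=> /andP[? ?]; apply/andP; split; lra.
have [c [cN Hc]] := porous_colouring M0 etaM porous j cube.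
set N := (M ^ m).-1 in cN *.
have N0 : (0 < N ^ j)%N by exact: leq_ltn_trans (cN a0 (HS _)).
have := colour_pairs R N0 (fun i => cN i (HS _)).
have pairs : \sum_(i : I) \sum_(i' : I) (c i == c i')%:R <= \sum_p w p ^+ m :> R.
  have HT3 : \sum_p (`|v p *m T| <= d)%R%:R <= \sum_p w p ^+ m.
    rewrite (eq_bigr (fun p => 1 * (`|v p *m T| <= d)%R%:R)); last first.
      by move=> p _; rewrite mul1r.
    rewrite [leRHS](eq_bigr (fun p => 1 * w p ^+ m)) => [//|p _].
    by rewrite mul1r.
  rewrite pair_big/=; apply: le_trans HT3.
  apply: ler_sum => p _; case: eqP => [cc|_]; last by [].
  rewrite (_ : _ <= d)//; have := Hc p.1 p.2 (HS _) (HS _) cc.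
  by rewrite -mulmxBl -/(v p) HT' ler_pdivrMr// dL mulrC.
have wv p : w p * `|v p| <= 3 * d.
  rewrite /w; case: (leP `|v p| d) => [vd|vd]; first by rewrite mul1r; lra.
  by rewrite divfK// gt_eqF// (lt_trans d0).
have diam' p : `|v p| <= M%:R ^+ j.+1 * r.
  apply: le_trans (diam _ _) _; rewrite exprS -mulrA ler_pM2r ?ler_nat//.
  by rewrite mulr_gt0// exprn_gt0.
(* The term at the least [i] with [|v p| <= M^i * r] already suffices; the other terms are
   nonnegative. *)
have level p : w p ^+ m <=
    \sum_(i < j.+2) (`|v p| <= M%:R ^+ i * r)%R%:R * (D / (M%:R ^+ m) ^+ i).
  have ex : exists i, `|v p| <= M%:R ^+ i * r by exists j.+1.
  case: (ex_minnP ex) => i Hi Hmin.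
  have ij : (i < j.+2)%N by rewrite ltnS; exact: Hmin.
  have wi : w p <= 12 * n%:R * M%:R / M%:R ^+ i.
    case: i Hi Hmin {ij} => [|k] Hi Hmin.
      rewrite expr0 divr1; apply: (@le_trans _ _ 3).
        rewrite /w; case: (leP `|v p| d) => [_|vd]; first by lra.
        by rewrite ler_pdivrMr ?(lt_trans d0)// ler_pM2l// ltW.
      have : 1 <= n%:R * M%:R :> R by rewrite -[leLHS]mulr1 ler_pM.
      by rewrite -mulrA; lra.
    have vk : M%:R ^+ k * r < `|v p|.
      by rewrite ltNge; apply/negP => /Hmin; rewrite ltnn.
    have k0 : 0 < M%:R ^+ k :> R by rewrite exprn_gt0.
    have -> : 12 * n%:R * M%:R / M%:R ^+ k.+1 = 3 * d / (M%:R ^+ k * r) :> R.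
      by rewrite /d exprS; field; rewrite !gt_eqF.
    rewrite ler_pdivlMr ?mulr_gt0//; apply: le_trans (wv p).
    by rewrite ler_wpM2l// ltW.
  rewrite (bigD1 (Ordinal ij))//= Hi mul1r -[leLHS]addr0; apply: lerD.
    rewrite /D exprAC -expr_div_n; apply: lerXn2r => //; rewrite nnegrE.
      exact: w0.
    by apply: divr_ge0; rewrite ?exprn_ge0// !mulr_ge0.
  by apply: sumr_ge0 => k _; rewrite mulr_ge0// divr_ge0// !exprn_ge0.
pose K := D * C * x ^+ j.+2 / (x - 1).
have sumw : \sum_p w p ^+ m <= #|I|%:R * K.
  have -> : \sum_p w p ^+ m = \sum_a \sum_b w (a, b) ^+ m.
    by rewrite pair_big; apply: eq_bigr => -[].
  rewrite mulr_natl -sumr_const; apply: ler_sum => a _.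
  apply: (@le_trans _ _ (\sum_b \sum_(i < j.+2)
      (`|v (a, b)| <= M%:R ^+ i * r)%R%:R * (D / (M%:R ^+ m) ^+ i))).
    by apply: ler_sum => b _; exact: level.
  rewrite exchange_big/=; apply: (@le_trans _ _ (\sum_(i < j.+2) D * C * x ^+ i)).
    apply: ler_sum => i _; rewrite -mulr_suml.
    have -> : \sum_b (`|v (a, b)| <= M%:R ^+ i * r)%R%:R =
        #|[pred b | `|e a - e b| <= M%:R ^+ i * r]|%:R :> R.
      rewrite -sum1_card natr_sum [RHS]big_mkcond/=; apply: eq_bigr => b _.
      by rewrite inE; case: ifP.
    have -> : D * C * x ^+ i = C * q ^+ i * (D / (M%:R ^+ m) ^+ i).
      by rewrite /x expr_div_n; ring.
    by rewrite ler_wpM2r// divr_ge0// !exprn_ge0.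
  have -> : K = (D * C) * (x ^+ j.+2 / (x - 1)) by rewrite /K mulrA.
  rewrite -mulr_sumr ler_wpM2l ?mulr_ge0//.
  exact: geometric_sum_le.
have I0 : 0 < #|I|%:R :> R by rewrite ltr0n; apply/card_gt0P; exists a0.
(* The lower bound from the colours meets the upper bound from averaging, and one factor [#|I|]
   cancels. *)
move=> H; have {H} : #|I|%:R * #|I|%:R <= #|I|%:R * ((N ^ j)%:R * K).
  rewrite -expr2 mulrCA; apply: le_trans H _; rewrite ler_wpM2l//.
  exact: le_trans pairs sumw.
rewrite ler_pM2l// => H; apply: le_trans H _; rewrite le_eqVlt; apply/orP; left.
have E : q * N%:R / M%:R ^+ m = x * N%:R by rewrite /x mulrAC.
have E2 : x ^+ j.+2 = x ^+ 2 * x ^+ j by rewrite -exprD.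
apply/eqP; rewrite /K /C' E natrX E2 [(x * _) ^+ j]exprMn.
by move: (x ^+ 2) (x ^+ j) (N%:R ^+ j) (x - 1)^-1 => a b c' d'; ring.
Qed.

End RandomProjection.

(** * Packing bounds and powers *)

Section Packing.
Variable R : realType.

Definition packing_bound n (A : set 'rV[R]_n) (b : R) := exists2 C : R, 0 <= C &
  forall x r r' (I : finType) (f : I -> 'rV[R]_n), A x -> 0 < r -> r <= r' ->
    (forall i, A (f i) /\ `|f i - x| <= r') ->
    (forall i j, i != j -> r <= `|f i - f j|) -> #|I|%:R <= C * (r' / r) `^ b.

Lemma powR_inv_base (x b : R) : 0 <= x -> x^-1 `^ b = (x `^ b)^-1.
Proof. by move=> x0; rewrite -powR_inv1// -powRrM mulN1r powRN. Qed.

Lemma net_ge0 n r (S : set 'rV[R]_n) : (0 <= net r S)%E.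
Proof.
apply: ereal_sup_ubound; exists 0%N => //.
by exists (fun=> 0); split=> -[].
Qed.

Lemma assouad_boundedP n (A : set 'rV[R]_n) b :
  assouad_bounded A b <-> packing_bound A b.
Proof.
split=> [[C HC]|[C C0 HC]].
  (* Doubling the outer radius gives the strict inequality [r < 2 * r']; the factor 2^b pays for
     it. *)
  pose C' := `|C| * 2 `^ b; exists C'; first by rewrite mulr_ge0// powR_ge0.
  move=> x r r' I f Ax r0 rr' Af sepf.
  have r'0 : 0 < r' := lt_le_trans r0 rr'.
  have r2 : r < 2 * r' by lra.
  have p0 : 0 < (r / (2 * r')) `^ b by rewrite powR_gt0// divr_gt0// mulr_gt0.
  have netI : (#|I|%:R%:E <= net r [set y | A y /\ (`|y - x| <= 2 * r')%R])%E.
    apply: ereal_sup_ubound; exists #|I| => //; exists (fun i => f (enum_val i)).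
    split=> [i|i j ij]; last by apply: sepf; rewrite (inj_eq enum_val_inj).
    by have [Af1 Af2] := Af (enum_val i); split=> //; lra.
  have H := le_trans (lee_abs _) (HC x r (2 * r') Ax r0 r2).
  have {}H : (r / (2 * r')) `^ b * #|I|%:R <= `|C|.
    rewrite -lee_fin EFinM; apply: le_trans (le_trans H _); last first.
      by rewrite lee_fin ler_norm.
    by rewrite lee_pmul2l// lte_fin.
  have -> : C' * (r' / r) `^ b = `|C| / (r / (2 * r')) `^ b.
    rewrite /C' -mulrA -powRM ?divr_ge0 ?(ltW r0) ?(ltW r'0)//.
    rewrite -powR_inv_base ?divr_ge0 ?mulr_ge0 ?(ltW r0) ?(ltW r'0)//.
    by rewrite invf_div mulrA.
  by rewrite ler_pdivlMr// mulrC.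
exists C => x r r' Ax r0 rr'.
have r'0 : 0 < r' := lt_trans r0 rr'.
have p0 : 0 < (r / r') `^ b by rewrite powR_gt0// divr_gt0.
rewrite gee0_abs; last by rewrite mule_ge0 ?net_ge0// lee_fin ltW.
rewrite -lee_pdivlMl// muleC -EFinM.
apply: ge_ereal_sup => _ [k [f [Af sepf]] <-].
rewrite lee_fin; have := HC x r r' 'I_k f Ax r0 (ltW rr') Af sepf.
by rewrite card_ord -powR_inv_base ?divr_ge0 ?(ltW r0) ?(ltW r'0)// invf_div.
Qed.

(** Each cell of a grid of side [r] holds at most one point of the family, and an axis has at most 2
    r' / r + 1 <= 3 r' / r cells. *)
Lemma packing_bound_dim n (A : set 'rV[R]_n) : packing_bound A n%:R.
Proof.
exists (3 ^+ n); first by rewrite exprn_ge0.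
move=> x r r' I f Ax r0 rr' Af sepf.
have r'0 : 0 < r' := lt_le_trans r0 rr'.
pose Q := (Num.truncn (2 * r' / r)).+1.
pose cell i : {ffun 'I_n -> 'I_Q} :=
  [ffun l => inord (Num.truncn ((f i 0 l - x 0 l + r') / r))].
have pos i l : 0 <= f i 0 l - x 0 l + r' <= 2 * r'.
  have [_ fx] := Af i; have := le_trans (coord_norm_le (f i - x) l) fx.
  by rewrite !mxE ler_norml => /andP[? ?]; apply/andP; split; lra.
have cellE i l : nat_of_ord (cell i l) = Num.truncn ((f i 0 l - x 0 l + r') / r).
  rewrite ffunE inordK// /Q ltnS; have /andP[p1 p2] := pos i l.
  by apply: le_truncn; rewrite ler_pM2r ?invr_gt0.
have cell_inj : injective cell.
  move=> i j ij; apply/eqP; apply: contraT => /sepf; rewrite leNgt => /negP[].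
  apply/rV_norm_lt => // l; rewrite !mxE.
  have ij' := congr1 (fun c : {ffun 'I_n -> 'I_Q} => nat_of_ord (c l)) ij.
  rewrite !cellE in ij'.
  have /andP[p1 _] := pos i l; have /andP[p2 _] := pos j l.
  have /andP[] := truncn_itv (divr_ge0 p1 (ltW r0)).
  have /andP[] := truncn_itv (divr_ge0 p2 (ltW r0)).
  rewrite ij' -natr1 !ler_pdivlMr// !ltr_pdivrMr//.
  set t := _%:R => h1 h2 h3 h4; rewrite ltr_norml.
  by apply/andP; split; lra.
have := leq_card _ cell_inj; rewrite card_ffun !card_ord -(ler_nat R).
move=> /le_trans; apply; rewrite powR_mulrn ?divr_ge0 ?(ltW r0) ?(ltW r'0)//.
rewrite -exprMn natrX; apply: lerXn2r; rewrite ?nnegrE//.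
  by rewrite mulr_ge0// divr_ge0 ?ltW.
have : 1 <= r' / r by rewrite ler_pdivlMr// mul1r.
have : (Num.truncn (2 * r' / r))%:R <= 2 * r' / r.
  by rewrite truncn_le divr_ge0 ?mulr_ge0 ?ltW.
by rewrite /Q -natr1 -!mulrA; lra.
Qed.

Lemma packing_bound_sub n (A B : set 'rV[R]_n) b :
  A `<=` B -> packing_bound B b -> packing_bound A b.
Proof.
move=> AB [C C0 HC]; exists C => // x r r' I f Ax r0 rr' Af.
by apply: (HC x) => //; [exact: AB|move=> i; have [? ?] := Af i; split=> //; exact: AB].
Qed.

End Packing.

Section Powers.
Variables (R : realType) (M : expansion R).

Definition coord_thin n (A : set 'rV[R]_n) d :=
  forall f : 'I_d.+1 -> 'I_n, ~ has_interior [set colsub f x | x in A].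

Definition set_power n k (A : set 'rV[R]_n) : set 'rV[R]_(k * n) :=
  [set v | forall i, A (row i (vec_mx v))].

(** Pigeonhole: among k d + 1 coordinates of the power, some d + 1 belong to the same factor, and
    projecting to these gives a projection of A. *)
Lemma coord_thin_power n k d (A : set 'rV[R]_n) :
  coord_thin A d -> coord_thin (set_power (k := k) A) (k * d).
Proof.
move=> thinA f intf.
have Hf l : exists p : 'I_k * 'I_n, f l = mxvec_index p.1 p.2.
  by case: (mxvec_indexP (f l)) => i j; exists (i, j).
have [p Hp] := choice Hf.
have [i Hi] : exists i, (d < #|[pred l | (p l).1 == i]|)%N.
  apply: contrapT => H; have := leqnn (k * d).+1; apply/negP; rewrite -leqNgt.
  rewrite -[X in (X <= _)%N]card_ord -sum1_card.
  rewrite (partition_big (fun l => (p l).1) xpredT)//=.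
  rewrite -[X in (_ <= X * _)%N]card_ord -sum_nat_const; apply: leq_sum => i _.
  rewrite sum1_card leqNgt; apply/negP => Hi; apply: H; exists i.
  by apply: leq_trans Hi _; rewrite subset_leq_card//; apply/subsetP.
pose g (l : 'I_d.+1) := enum_val (widen_ord Hi l).
have g_inj : injective g by move=> l l' /enum_val_inj/(congr1 val)/= /val_inj.
have gi l : (p (g l)).1 = i.
  by have := enum_valP (widen_ord Hi l); rewrite inE => /eqP.
apply: (thinA (fun l => (p (g l)).2)).
apply: has_interior_sub (has_interior_colsub g_inj intf) => _ [_ [v Av <-] <-].
exists (row i (vec_mx v)); first exact: Av.
by apply/rowP => l; rewrite !mxE Hp -(gi l).
Qed.

Lemma closed_power n k (A : set 'rV[R]_n) :
  closed A -> closed (set_power (k := k) A).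
Proof.
move=> cA; apply: closedP => v Hv i; apply: cA; apply/closureP => e e0.
have [w wv Aw] := Hv e e0; exists (row i (vec_mx w)) => //.
apply: le_lt_trans wv; apply/rV_norm_le => // l.
by have := coord_norm_le (w - v) (mxvec_index i l); rewrite !mxE.
Qed.

Lemma definable_power n k (A : set 'rV[R]_n) :
  definable M A -> definable M (set_power (k := k) A).
Proof. by move=> dA; rewrite /set_power; definability. Qed.

End Powers.

(** * The upper bound for the Assouad dimension *)

Section UpperBound.
Variables (R : realType) (M : expansion R).

Lemma powR_expr (x b : R) i : 0 <= x -> (x ^+ i) `^ b = (x `^ b) ^+ i.
Proof.
move=> x0; rewrite -(powR_mulrn i x0) -(powR_mulrn i (powR_ge0 _ _)).
by rewrite -!powRrM mulrC.
Qed.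

Lemma ltr_powR_exp (a x y : R) : 1 < a -> x < y -> a `^ x < a `^ y.
Proof.
move=> a1 xy; have a0 : 0 < a := lt_trans ltr01 a1.
by rewrite /powR gt_eqF// ltr_expR ltr_pM2r// ln_gt0.
Qed.

Definition power_point n k (I : finType) (f : I -> 'rV[R]_n) (p : {ffun 'I_k -> I}) :
  'rV[R]_(k * n) := mxvec (\matrix_(i, l) f (p i) 0 l).

Lemma power_point_in n k (I : finType) (f : I -> 'rV[R]_n) A (p : {ffun 'I_k -> I}) :
  (forall i, A (f i)) -> set_power A (power_point f p).
Proof.
move=> Af i; rewrite mxvecK (_ : row i _ = f (p i))//.
by apply/rowP => l; rewrite !mxE.
Qed.

Lemma power_point_dist n k (I : finType) (f : I -> 'rV[R]_n) (p q : {ffun 'I_k -> I}) (e : R) :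
  0 <= e -> (`|power_point f p - power_point f q| <= e) =
    [forall i, `|f (p i) - f (q i)| <= e].
Proof.
move=> e0; have entry i l :
    (power_point f p - power_point f q) 0 (mxvec_index i l) = (f (p i) - f (q i)) 0 l.
  by rewrite !mxE !mxvecE !mxE.
apply/idP/forallP => [/(rV_norm_le _ e0) H i|H].
  by apply/rV_norm_le => // l; rewrite -entry.
apply/rV_norm_le => // l; case: (mxvec_indexP l) => i l'.
by rewrite entry; apply: (rV_norm_le _ e0).1.
Qed.

Lemma card_family_le (T I : finType) (F : T -> pred I) (y : R) :
  (forall t, #|F t|%:R <= y) -> #|family F|%:R <= y ^+ #|T|.
Proof.
move=> Fy; rewrite card_family cardE /image_mem.
elim: (enum T) => [|t s IH] /=; first by rewrite expr0.
by rewrite natrM exprS ler_pM.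
Qed.

(** [B] is fixed before the exponents, since [b] will be taken close to the infimum once the gain
    determined by [B] is known. The points counted are the k-tuples of a separated family, and a
    k-th root is taken at the end. *)
Lemma packing_improve n d k (A : set 'rV[R]_n) : tame M -> definable M A -> closed A ->
  coord_thin A d -> (0 < n)%N -> (0 < k)%N ->
  exists2 B : nat, (1 < B)%N & forall b c : R, 0 <= c ->
    let m := (k * d).+1 in B%:R ^+ m < (B%:R `^ b) ^+ k ->
    (B%:R `^ b) ^+ k * (B ^ m).-1%:R / B%:R ^+ m <= (B%:R `^ c) ^+ k ->
    packing_bound A b -> packing_bound A c.
Proof.
move=> tM dA cA thinA n0 k0.
pose G := set_power (k := k) A.
have dG : definable M G by exact: definable_power.
have cG : closed G by exact: closed_power.
have nG (T : 'M[R]_(k * n, (k * d).+1)) : nwd [set g *m T | g in G].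
  by apply: (nwd_linear_image tM) => //; exact: coord_thin_power.
have [eta eta0 porous] := uniform_porosity tM dG cG nG.
pose B := (Num.truncn eta^-1).+2.
have B1 : (1 < B)%N by [].
have BR : 0 < B%:R :> R by rewrite ltr0n.
have etaB : B%:R^-1 <= eta.
  rewrite -[leRHS]invrK lef_pV2 ?posrE ?invr_gt0//.
  by rewrite ltW// (lt_le_trans (truncnS_gt _))// ler_nat.
exists B => // b c c0 m; set q := (B%:R `^ b) ^+ k => qB qc [C C0 HC].
have kn0 : (0 < k * n)%N by rewrite muln_gt0 k0.
have [C' C'0 count] := porous_count kn0 B1 etaB (exprn_ge0 k C0) qB.
(* The summand 1 ensures [C' <= D ^+ k], which prepares the k-th root. *)
pose D : R := 1 + C'; have D1 : 1 <= D by rewrite lerDl.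
exists (D * B%:R `^ c); first by rewrite mulr_ge0 ?powR_ge0// (le_trans ler01).
move=> x r r' I f Ax r0 rr' Af sepf.
have r'0 : 0 < r' := lt_le_trans r0 rr'.
have rat1 : 1 <= r' / r by rewrite ler_pdivlMr// mul1r.
(* [j] is the number of scales: [B^j] equals [r' / r] up to a factor [B]. *)
have [j j1 j2] : exists2 j, r' / r <= B%:R ^+ j & B%:R ^+ j <= B%:R * (r' / r).
  have ex : exists j, r' / r <= B%:R ^+ j.
    exists (Num.truncn (r' / r)).+1; apply: ltW; apply: lt_le_trans (truncnS_gt _) _.
    by rewrite -natrX ler_nat ltnW// ltn_expl.
  case: (ex_minnP ex) => j Hj Hmin; exists j => //.
  case: j Hj Hmin => [|j] Hj Hmin.
    by rewrite expr0 mulr_ege1// ler1n.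
  rewrite exprS ler_pM2l// leNgt; apply/negP => /ltW/Hmin.
  by rewrite ltnn.
have Bj0 i : 0 <= B%:R ^+ i * r by rewrite mulr_ge0 ?exprn_ge0// ltW.
have : #|{ffun 'I_k -> I}|%:R <= C' * (q * (B ^ m).-1%:R / B%:R ^+ m) ^+ j.
  apply: (count _ (power_point (k := k) f) j r r0) => [y T|p p'|p i].
  (* The sum of all norms bounds the finitely many tuples at once. *)
  - have [z zc Hz] := porous (\sum_p `|power_point (k := k) f p|) y T.
    exists z => // p; apply: Hz; first by apply: power_point_in => i; exact: (Af i).1.
    by rewrite (bigD1 p)//= lerDl sumr_ge0.
  - rewrite power_point_dist; last by rewrite mulr_ge0.
    apply/forallP => i; have [_ f1] := Af (p i); have [_ f2] := Af (p' i).
    rewrite ler_pdivrMr// in j1.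
    rewrite -(subrKA x) (le_trans (ler_normD _ _))// [`|x - _|]distrC.
    by lra.
  (* In the sup norm a ball of tuples is a product of balls, so its count is a product of [k] counts
     in A. *)
  - have -> : C ^+ k * q ^+ i = (C * (B%:R `^ b) ^+ i) ^+ #|'I_k|.
      by rewrite card_ord exprMn /q exprAC.
    rewrite (eq_card (B := family (fun l => [pred t | `|f (p l) - f t| <= B%:R ^+ i * r]))).
      apply: card_family_le => l; rewrite -card_sig.
      have := HC (f (p l)) r (B%:R ^+ i * r) {t | `|f (p l) - f t| <= B%:R ^+ i * r}
        (fun t => f (val t)) (Af _).1 r0.
      have r0' : r != 0 by rewrite gt_eqF.
      rewrite (mulfK r0') (powR_expr _ _ (ltW BR)); apply.
      + by rewrite -[leLHS]mul1r ler_pM2r// exprn_ege1// ler1n.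
      + by move=> [t Pt]; split; [exact: (Af _).1|rewrite /= distrC].
      + by move=> t t' tt'; apply: sepf; rewrite (inj_eq val_inj).
    by move=> p'; rewrite [LHS]inE power_point_dist//.
rewrite card_ffun card_ord natrX => H.
have {}H : #|I|%:R ^+ k <= (D * (B%:R ^+ j) `^ c) ^+ k.
  apply: le_trans H _; rewrite [leRHS]exprMn (powR_expr _ _ (ltW BR)) [X in _ <= _ * X]exprAC.
  apply: ler_pM => //.
  - by rewrite exprn_ge0// divr_ge0 ?exprn_ge0// mulr_ge0// exprn_ge0// powR_ge0.
  - by apply: le_trans (ler_eXnr k0 D1); rewrite /D lerDr.
  - apply: lerXn2r => //; rewrite nnegrE ?exprn_ge0 ?powR_ge0//.
    by rewrite divr_ge0 ?exprn_ge0// mulr_ge0// exprn_ge0// powR_ge0.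
have D0 : 0 <= D := le_trans ler01 D1.
rewrite ler_pXn2r ?nnegrE ?mulr_ge0 ?powR_ge0// in H.
apply: le_trans H _; rewrite -mulrA ler_wpM2l//.
rewrite -powRM ?(ltW BR) ?divr_ge0 ?(ltW r0) ?(ltW r'0)//.
apply: ge0_ler_powR => //; rewrite nnegrE ?exprn_ge0// ?(ltW BR)//.
by rewrite mulr_ge0 ?(ltW BR)// divr_ge0// ltW.
Qed.

Lemma assouad_dim_le n d (A : set 'rV[R]_n) : tame M -> definable M A -> closed A ->
  coord_thin A d -> (0 < n)%N -> (assouad_dim A <= d%:R%:E)%E.
Proof.
move=> tM dA cA thinA n0; rewrite leNgt; apply/negP => dA'.
have An : (assouad_dim A <= n%:R%:E)%E.
  apply: ereal_inf_lbound; exists n%:R => //.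
  by apply/assouad_boundedP; exact: packing_bound_dim.
have fA : assouad_dim A \is a fin_num.
  rewrite fin_numE; apply/andP; split; apply/eqP => E.
    by rewrite E in dA'.
  by rewrite E in An.
pose a := fine (assouad_dim A); have aE : assouad_dim A = a%:E by rewrite fineK.
have da : d%:R < a by rewrite -lte_fin -aE.
(* With this [k], the number B^(b k) exceeds B^m for every [b >= a]. *)
pose k := (Num.truncn (a - d%:R)^-1).+1.
have ka : 1 < k%:R * (a - d%:R).
  by rewrite mulrC -ltr_pdivrMl ?subr_gt0// mulr1 truncnS_gt.
have kpos : (0 < k)%N by [].
clearbody k a.
have [B B1 improve] := packing_improve tM dA cA thinA n0 kpos.
have mE : (k * d).+1%:R = k%:R * d%:R + 1 :> R by rewrite -natr1 natrM.
set m := (k * d).+1 in improve mE.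
have B1R : 1 < B%:R :> R by rewrite ltr1n.
have B0R : 0 < B%:R :> R := lt_trans ltr01 B1R.
have Bm0 : 0 < B%:R ^+ m :> R by rewrite exprn_gt0.
have Bm1 : (1 < B ^ m)%N by rewrite -[1%N](expn0 B) ltn_exp2l.
pose t : R := (B ^ m).-1%:R / B%:R ^+ m.
have t0 : 0 < t.
  by rewrite divr_gt0// ltr0n -ltnS prednK// ltnW.
have t1 : t < 1.
  by rewrite ltr_pdivrMr// mul1r -natrX ltr_nat prednK// ltnW.
have k0 : 0 < k%:R :> R by rewrite ltr0n.
have lnB : 0 < ln B%:R :> R by rewrite ln_gt0.
(* [s] solves B^(-s k) = t: the fraction t = 1 - B^(-m) of surviving cells lowers the exponent by
   [s]. *)
pose s := - ln t / (k%:R * ln B%:R).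
have s0 : 0 < s by rewrite divr_gt0 ?mulr_gt0// oppr_gt0 ln_lt0// t0.
have tE : t = B%:R `^ (- (s * k%:R)).
  rewrite /powR gt_eqF// -[LHS]lnK ?posrE//; congr expR.
  by rewrite /s; field; rewrite !gt_eqF.
have [|_ [b Ab <-] bs] := @ereal_inf_lt _ [set c%:E | c in assouad_bounded A] (a + s)%:E.
  by rewrite -/(assouad_dim A) aE lte_fin ltrDl.
have ab : a <= b by rewrite -lee_fin -aE; apply: ereal_inf_lbound; exists b.
rewrite lte_fin in bs.
(* Since [b < a + s], the exponent [c] is below the infimum [a]; the maximum with 0 keeps it
   nonnegative and is harmless because [0 <= d < a]. *)
pose c := Num.max 0 (b - s).
have ca : c < a by rewrite gt_max (le_lt_trans _ da)//= ltrBlDr.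
have Ac : assouad_bounded A c.
  apply/assouad_boundedP; apply: (improve b c); last exact/assouad_boundedP.
  - by rewrite le_max lexx.
  - rewrite -(powR_mulrn m (ltW B0R)) -(powR_mulrn k (powR_ge0 _ _)) -powRrM.
    apply: ltr_powR_exp => //.
    rewrite mE; apply: (@lt_le_trans _ _ (a * k%:R)).
      by move: ka; rewrite mulrBr ltrBrDr addrC (mulrC a).
    by rewrite ler_pM2r.
  - rewrite -mulrA -/t tE -!(powR_mulrn k (powR_ge0 _ _)) -!powRrM -powRD; last first.
      by rewrite implybE (gt_eqF B0R) orbT.
    apply: ler_powR; first exact: ltW.
    by rewrite -mulrBl ler_pM2r// le_max lexx orbT.
have : a <= c by rewrite -lee_fin -aE; apply: ereal_inf_lbound; exists c.
by rewrite leNgt ca.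
Qed.

End UpperBound.

(** * The lower bound and the equivalence *)

Section LowerBound.
Variable R : realType.

(** Approximate lifts of a grid of K^k points are separated points of A within a fixed distance of
    [x0]. This gives K^k <= D K^b for all K, which forces k <= b. *)
Lemma packing_exponent_ge n k (lam : 'I_k -> 'I_n) (A : set 'rV[R]_n) x0 (N : R) v e b :
  A x0 -> 0 < e ->
  (forall w e', 0 < e' -> `|w - v| < e -> exists a,
    [/\ A a, `|a - x0| <= N & `|colsub lam a - w| < e']) ->
  packing_bound A b -> k%:R <= b.
Proof.
move=> Ax0 e0 dense [C C0 HC].
pose r' := Num.max N e; have r'e : e <= r' by rewrite le_max lexx orbT.
have r'0 : 0 < r' := lt_le_trans e0 r'e.
pose D := C * (4 * r' / e) `^ b.
have D0 : 0 <= D by rewrite mulr_ge0// powR_ge0.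
have HK (K : nat) : (0 < K)%N -> K%:R ^+ k <= D * K%:R `^ b.
  move=> K0; have KR : 0 < K%:R :> R by rewrite ltr0n.
  (* Grid points [u] apart, lifted with an error below [u / 4], stay [u / 2] apart. *)
  pose u := e / (2 * K%:R); have u0 : 0 < u by rewrite divr_gt0// mulr_gt0.
  pose w (p : {ffun 'I_k -> 'I_K}) : 'rV[R]_k := v + \row_l (u * (p l)%:R).
  have wv p : `|w p - v| < e.
    apply: (@le_lt_trans _ _ (e / 2)); last by lra.
    have e20 : 0 <= e / 2 by lra.
    rewrite /w addrC addKr; apply/(rV_norm_le _ e20) => l.
    have up0 : 0 <= u * (p l)%:R by rewrite mulr_ge0// ltW.
    rewrite mxE (ger0_norm up0).
    have -> : e / 2 = u * K%:R by rewrite /u; field; rewrite gt_eqF.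
    by rewrite ler_pM2l// ler_nat ltnW.
  have u4 : 0 < u / 4 by rewrite divr_gt0.
  have [a Ha] := choice (fun p => dense (w p) (u / 4) u4 (wv p)).
  have : #|{ffun 'I_k -> 'I_K}|%:R <= C * (r' / (u / 2)) `^ b.
    apply: (HC x0 _ _ _ a) => //; first by rewrite divr_gt0.
    - apply: le_trans r'e; rewrite /u ler_pdivrMr// ler_pdivrMr ?mulr_gt0//.
      have : 1 <= K%:R :> R by rewrite ler1n.
      by nra.
    - move=> p; have [Aa aN _] := Ha p; split=> //.
      by rewrite le_max aN.
    move=> p q /eqP pq; have [_ _ h1] := Ha p; have [_ _ h2] := Ha q.
    have {pq} [l pql] : exists l, p l != q l.
      apply/existsP; apply: contra_notT pq; rewrite negb_exists => /forallP H.
      by apply/ffunP => l; apply/eqP; have := H l; rewrite negbK.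
    have h3 := le_lt_trans (coord_norm_le _ l) h1.
    have h4 := le_lt_trans (coord_norm_le _ l) h2.
    apply: le_trans (coord_norm_le _ (lam l)).
    move: h3 h4; rewrite !mxE; set x := a p 0 (lam l); set y := a q 0 (lam l).
    rewrite !ltr_norml => /andP[? ?] /andP[? ?].
    have [pq|qp] : (p l < q l)%N \/ (q l < p l)%N.
      by case: (ltngtP (p l) (q l)) => [||/val_inj E]; [left|right|rewrite E eqxx in pql].
    - have : u * (p l).+1%:R <= u * (q l)%:R by rewrite ler_pM2l// ler_nat.
      by rewrite -natr1 mulrDr mulr1 => ?; rewrite ler_normr; apply/orP; right; lra.
    - have : u * (q l).+1%:R <= u * (p l)%:R by rewrite ler_pM2l// ler_nat.
      by rewrite -natr1 mulrDr mulr1 => ?; rewrite ler_normr; apply/orP; left; lra.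
  rewrite card_ffun !card_ord natrX => /le_trans; apply.
  rewrite /D -mulrA -powRM ?(ltW KR)//; last first.
    by rewrite divr_ge0 ?(ltW e0)// mulr_ge0// ltW.
  rewrite (_ : r' / (u / 2) = 4 * r' / e * K%:R)// /u.
  by field; rewrite !gt_eqF.
rewrite leNgt; apply/negP => bk; pose s := k%:R - b.
have s0 : 0 < s by rewrite subr_gt0.
(* Chosen so that [K >= y] gives K^s >= D + 1, against K^s <= D. *)
pose y := (D + 1) `^ s^-1; have y0 : 0 <= y := powR_ge0 _ _.
have D10 : 0 <= D + 1 by rewrite addr_ge0.
pose K := (Num.truncn y).+1; have yK : y <= K%:R by rewrite ltW// truncnS_gt.
have KR : 0 < K%:R :> R by rewrite ltr0n.
have := HK K (ltn0Sn _); rewrite -powR_mulrn ?(ltW KR)//.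
have -> : k%:R = s + b by rewrite subrK.
rewrite powRD; last by rewrite (gt_eqF KR) implybT.
rewrite ler_pM2r ?powR_gt0//; apply/negP; rewrite -ltNge.
apply: (@lt_le_trans _ _ (D + 1)); first by rewrite ltrDl.
have -> : D + 1 = y `^ s by rewrite /y -powRrM mulVf ?gt_eqF// powRr1.
by apply: ge0_ler_powR; rewrite ?nnegrE// ltW.
Qed.

Lemma topdim_le_assouad_dim n (A : set 'rV[R]_n) : (topdim A <= assouad_dim A)%E.
Proof.
apply: ge_ereal_sup => _ [k [lam [_ /has_interiorE[v [e e0 Hv]]]] <-].
apply: le_ereal_inf_tmp => _ [b /assouad_boundedP Ab <-]; rewrite lee_fin.
have [x0 Ax0 _] := Hv v (ltac:(by rewrite subrr normr0)).
(* A is exhausted by balls about [x0]; their projections cover a ball, so one of them is somewhere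
   dense. *)
pose F (N : nat) := [set w | exists a, [/\ A a, `|a - x0| <= N%:R & colsub lam a = w]].
have [N /not_nwd[v' [e' e'0 H]]] : exists N, ~ nwd (F N).
  apply: contrapT => nF; have {}nF N : nwd (F N).
    by apply: contrapT => H; apply: nF; exists N.
  have [w wv Hw] := baire nF v e0; have [a Aa aw] := Hv w wv.
  apply: (Hw (Num.truncn `|a - x0|).+1); exists a; split=> //.
  by rewrite ltW// truncnS_gt.
apply: (packing_exponent_ge (lam := lam) (N := N%:R) Ax0 e'0 _ Ab) => w d d0 wv'.
have [u uw [a [Aa aN au]]] := H w d d0 wv'.
by exists a; split=> //; rewrite au.
Qed.

End LowerBound.

Section Sorting.

(** Links the increasing maps in [topdim] with arbitrary injective maps: [lam] lists the range of
    [f] in increasing order. *)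
Lemma sorted_reindex n d (f : 'I_d -> 'I_n) : injective f ->
  exists lam : 'I_d -> 'I_n, {homo lam : i j / (i < j)%N} /\
    exists2 g : 'I_d -> 'I_d, injective g & forall i, lam i = f (g i).
Proof.
move=> finj; pose s := [seq x <- enum 'I_n | x \in codom f].
have szs : size s = d.
  rewrite -[RHS]card_ord -(card_codom finj) cardE; apply: perm_size.
  apply: uniq_perm => [||x]; [exact/filter_uniq/enum_uniq|exact: enum_uniq|].
  by rewrite mem_filter !mem_enum andbT.
have srt : sorted (fun i j : 'I_n => (i < j)%N) s.
  apply: sorted_filter => [x y z|]; first exact: ltn_trans.
  have := iota_ltn_sorted 0 n; rewrite -val_enum_ord sorted_map.
  by apply: sub_sorted => x y.
have sf : {subset s <= codom f} by move=> x; rewrite mem_filter => /andP[].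
case: d f finj s szs srt sf => [|d] f finj s szs srt sf.
  by exists f; split=> [[]//|]; exists id => // -[].
pose lam (i : 'I_d.+1) := nth (f ord0) s i.
have lam_lt : {homo lam : i j / (i < j)%N}.
  move=> i j ij; apply: (sorted_ltn_nth _ (f ord0) srt) => //.
  - by move=> x y z; exact: ltn_trans.
  - by rewrite inE szs.
  - by rewrite inE szs.
have inl i : lam i \in codom f by apply: sf; apply: mem_nth; rewrite szs.
exists lam; split=> //; exists (fun i => iinv (inl i)); last by move=> i; rewrite f_iinv.
move=> i j /(congr1 f); rewrite !f_iinv => lij.
apply: val_inj; case: (ltngtP i j) => // /lam_lt; by rewrite lij ltnn.
Qed.

End Sorting.

Section Main.
Variables (R : realType) (M : expansion R).

(** An injective [f] is increasing up to a permutation of coordinates; for any other [f] the image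
    lies in a diagonal. *)
Lemma coord_thin_sorted n d (A : set 'rV[R]_n) :
  (forall lam : 'I_d.+1 -> 'I_n, {homo lam : i j / (i < j)%N} ->
    ~ has_interior [set colsub lam x | x in A]) -> coord_thin A d.
Proof.
move=> thinA f intf; have [finj|] := pselect (injective f).
  have [lam [lam_lt [g ginj lamE]]] := sorted_reindex finj.
  apply: (thinA lam lam_lt).
  apply: has_interior_sub (has_interior_colsub ginj intf) => _ [_ [x Ax <-] <-].
  by exists x => //; apply/rowP => i; rewrite !mxE lamE.
move=> /existsNP[i /existsNP[j /not_implyP[fij ij]]].
case: intf => v [e e0 Hv].
(* Only coordinate [i] of [v] moves; c = 0 and c = e / 2 cannot both give points of the diagonal. *)
pose w (c : R) : 'rV[R]_d.+1 := v + c *: delta_mx 0 i.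
have wE c : `|c| < e -> w c 0 i = w c 0 j.
  move=> ce; have [|x _ <-] := Hv (w c); last by rewrite !mxE fij.
  rewrite /w addrC addKr; apply/rV_norm_lt => // l; rewrite !mxE eqxx /=.
  by case: (l == i); rewrite ?mulr1// mulr0 normr0.
have := wE 0; rewrite normr0 => /(_ e0); have := wE (e / 2).
rewrite gtr0_norm ?divr_gt0// => /(_ (ltac:(lra))).
rewrite !mxE !eqxx /= (_ : j == i = false) ?mulr1 ?mulr0; last first.
  by apply/eqP => ji; apply: ij.
move=> h1 h2; have /addrI/eqP := etrans h1 (esym h2).
by rewrite gt_eqF// divr_gt0.
Qed.

(** The projection of the closure lies in the closure of the projection, which is nowhere dense by
    [tame_rV]. *)
Lemma coord_thin_closure n d (A : set 'rV[R]_n) : tame M -> definable M A ->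
  coord_thin A d -> coord_thin (closure A) d.
Proof.
move=> tM dA thinA f.
have dfA : definable M [set colsub f x | x in A].
  have : dpred M (fun y => exists x : 'rV_n, A x /\ colsub f x = y) by definability.
  by apply: dpred_ext => y; split=> -[x]; [case=> ? <-|move=> ? <-]; exists x.
have nw := tame_rV tM dfA (thinA f).
apply: nwd_no_interior (nwd_sub _ (nwd_closure nw)) => _ [x /closureP cx <-].
apply/closureP => e /cx[a ax Aa]; exists (colsub f a); last by exists a.
by rewrite -colsubB (le_lt_trans (colsub_norm _ _)).
Qed.

Lemma assouad_dim_subset n (A B : set 'rV[R]_n) :
  A `<=` B -> (assouad_dim A <= assouad_dim B)%E.
Proof.
move=> AB; apply: le_ereal_inf => _ [b /assouad_boundedP Bb <-]; exists b => //.
by apply/assouad_boundedP; exact: packing_bound_sub AB Bb.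
Qed.

Lemma tame_assouad_dim_le n (A : set 'rV[R]_n) : tame M -> definable M A ->
  (assouad_dim A <= topdim A)%E.
Proof.
move=> tM dA; have [A0|A0] := pselect (A = set0).
  have -> : assouad_dim A = -oo%E.
    apply: eq_ninfty => b; apply: ereal_inf_lbound; exists b => //.
    by rewrite A0; exists 0.
  exact: leNye.
pose P (k : nat) := `[< exists lam : 'I_k -> 'I_n, {homo lam : i j / (i < j)%N} /\
  has_interior [set colsub lam x | x in A] >].
have P0 : exists k, P k.
  have lam0 : 'I_0 -> 'I_n by case.
  exists 0%N; apply/asboolP; exists lam0.
  split=> [[]//|]; have [x Ax] : A !=set0 by apply/set0P/eqP.
  exists 0, 1 => // w _; by exists x => //; apply/rowP; case.
have Pn k : P k -> (k <= n)%N.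
  move=> /asboolP[lam [lam_lt _]]; rewrite -[k]card_ord -[n]card_ord.
  apply: (leq_card lam) => i j ij; apply: val_inj.
  by case: (ltngtP i j) => // /lam_lt; rewrite ij ltnn.
case: (ex_maxnP P0 Pn) => d /asboolP[lam [lam_lt intA]] dmax.
apply: (@le_trans _ _ d%:R%:E); last first.
  by apply: ereal_sup_ubound; exists d => //; exists lam; split=> //; exact/has_interiorE.
(* In R^0 the trivial bound by [n] is enough; [assouad_dim_le] takes [n] positive. *)
have [n0|n0] := posnP n.
  apply: (@le_trans _ _ n%:R%:E); last by rewrite lee_fin ler_nat n0.
  apply: ereal_inf_lbound; exists n%:R => //; apply/assouad_boundedP.
  exact: packing_bound_dim.
apply: le_trans (assouad_dim_subset (@subset_closure _ A)) _.
apply: (assouad_dim_le tM) => //; first exact: dpred_closure.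
  exact: closed_closure.
apply: coord_thin_closure => //; apply: coord_thin_sorted => lam' lam'_lt intA'.
suff /dmax : P d.+1 by rewrite ltnn.
by apply/asboolP; exists lam'.
Qed.

(** A set dense in an interval but without interior has [topdim] at most 0, while by density its
    Assouad dimension is at least 1. *)
Lemma tame_of_dim_eq :
  (forall A : set 'rV[R]_1, definable M A -> topdim A = assouad_dim A) -> tame M.
Proof.
move=> H A dA; have [intA|nA] := pselect (has_interior A).
  by left; apply/has_interiorE.
right; apply/nowhere_denseE; apply: contrapT => /not_nwd[v [e e0 dense]].
pose A1 := [set x : 'rV[R]_1 | A (x 0 0)].
have top0 : (topdim A1 <= 0%:E)%E.
  apply: ge_ereal_sup => _ [k [lam [lam_lt /has_interiorE intA1]] <-].
  case: k lam lam_lt intA1 => [|k] lam _ intA1; first by rewrite lee_fin.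
  exfalso; apply: nA; case: intA1 => u [d d0 Hu].
  exists (u 0 0), d => // t tu.
  have [|x Ax /rowP/(_ 0)] := Hu (u + const_mx (t - u 0 0)).
    by rewrite addrC addKr; apply/rV_norm_lt => // l; rewrite mxE.
  by rewrite !mxE (ord1 (lam 0)) subrKC => <-.
have [_ [b Ab <-] b1] : exists2 y, [set b%:E | b in assouad_bounded A1] y & (y < 1%:E)%E.
  by apply: ereal_inf_lt; rewrite -/(assouad_dim A1) -H// (le_lt_trans top0)// lte_fin.
move: b1; rewrite lte_fin; apply/negP; rewrite -leNgt.
have [x0 xv Ax0] := dense v e e0 (ltac:(by rewrite subrr normr0)).
move/assouad_boundedP : Ab => Ab; rewrite -[1]/(1%:R).
(* The radius 3 e adds the distances from [a] to [w], from [w] to [v] and from [v] to [x0], each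
   below [e]. *)
apply: (packing_exponent_ge (lam := id) (x0 := const_mx x0) (N := 3 * e)
  (v := const_mx v) (e := e) _ e0 _ Ab).
  by rewrite /A1 /= mxE.
move=> w d d0 wv.
have m0 : 0 < Num.min d e by rewrite lt_min d0.
have wv' : `|w 0 0 - v| < e by have := (rV_norm_lt _ e0).1 wv 0; rewrite !mxE.
have [a aw Aa] := dense (w 0 0) _ m0 wv'.
move: aw; rewrite lt_min => /andP[ad ae].
exists (const_mx a); split; first by rewrite /A1 /= mxE.
  apply/rV_norm_le => [|l]; first by rewrite mulr_ge0// ltW.
  rewrite !mxE; move: xv ad ae wv'; rewrite !ltr_norml ler_norml.
  by move=> /andP[? ?] /andP[? ?] /andP[? ?] /andP[? ?]; apply/andP; split; lra.
by apply/rV_norm_lt => // l; rewrite !mxE (ord1 l).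
Qed.

End Main.

Theorem corollary1p4 (R : realType) (M : expansion R) :
  (forall A : set R, definable1 M A -> A° !=set0 \/ nowhere_dense A) <->
  (forall (n : nat) (A : set 'rV[R]_n),
     definable M A -> topdim A = assouad_dim A).
Proof.
split=> [tM n A dA|H]; last by apply: tame_of_dim_eq; exact: H.
apply/eqP; rewrite eq_le topdim_le_assouad_dim/=.
exact: (tame_assouad_dim_le (M := M)).
Qed.
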